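(* Suppose the bilinear form on $V$ is skew-symmetric. The maximal dimension of an irreducible component of $Z(r;V)$ is \begin{enumerate} \item $12r+3$ if $n=4$; \item $27r+6$ if $n=6$; \item $n^2r-2nr+3r+n-1$ if $n=2$ or $n\ge 8$. \end{enumerate}
   Context: $k$ is an algebraically closed field of characteristic different from $2$; $n,r$ are positive integers; $V=k^n$ is equipped with a nondegenerate bilinear form $\langle\cdot,\cdot\rangle$ (here skew-symmetric, so $n$ is even). $\rho$ is the adjoint involution on $\mathrm{End}_k(V)$, determined by $\langle\rho(A)v,w\rangle=\langle v,Aw\rangle$ for all $v,w\in V$. An $r$-tuple $A_\bullet=(A_1,\dots,A_r)\in\mathrm{End}_k(V)^r$ generates $\mathrm{End}_k(V)$ as an algebra with involution if every $B\in\mathrm{End}_k(V)$ is a noncommutative polynomial over $k$ in the $A_i$ and $\rho(A_i)$. $Z(r;V)\subseteq\mathrm{End}_k(V)^r$ is the closed subvariety (Zariski topology) of $r$-tuples that do not generate $\mathrm{End}_k(V)$ as an algebra with involution. *)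

(* Defs.v *)
From HB Require Import structures.
From mathcomp Require Import all_boot all_algebra.
From mathcomp Require Import boolp classical_sets.
From mathcomp Require Import mpoly.

Set Implicit Arguments.
Unset Strict Implicit.
Unset Printing Implicit Defensive.

Import GRing.Theory.
Local Open Scope classical_set_scope.
Local Open Scope ring_scope.

(* Dimension theory in the Zariski topology of the affine space k^m, whose
   points are the row vectors 'rV[k]_m. *)
Section Zariski.
Variables (k : fieldType) (m : nat).
Implicit Types (C D Z : set 'rV[k]_m).

Definition zclosed C : Prop :=
  exists S : set {mpoly k[m]},
    C = [set x : 'rV[k]_m | forall p, S p -> p.@[x 0] = 0].

(* Closedness in the subspace topology of Z. *)
Definition zclosed_in Z C : Prop := exists2 D, zclosed D & C = Z `&` D.

(* Irreducibility of C as a topological space: the empty set is not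
   irreducible. *)
Definition zirreducible C : Prop :=
  C !=set0 /\
  forall D1 D2, zclosed D1 -> zclosed D2 ->
    C `<=` D1 `|` D2 -> C `<=` D1 \/ C `<=` D2.

Definition irreducible_component Z C : Prop :=
  [/\ C `<=` Z, zirreducible C &
      forall D, D `<=` Z -> zirreducible D -> C `<=` D -> D = C].

(* There is a chain c 0 < c 1 < ... < c d of irreducible closed subsets of
   the space Z. *)
Definition has_chain Z (d : nat) : Prop :=
  exists c : nat -> set 'rV[k]_m,
    (forall i, (i <= d)%N -> zclosed_in Z (c i) /\ zirreducible (c i)) /\
    (forall i, (i < d)%N -> c i `<` c i.+1).

(* Krull dimension of the space Z. *)
Definition dim_le Z (d : nat) : Prop :=
  forall e, has_chain Z e -> (e <= d)%N.

Definition dim_eq Z (d : nat) : Prop := has_chain Z d /\ dim_le Z d.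

Definition max_component_dim Z (d : nat) : Prop :=
  (exists2 C, irreducible_component Z C & dim_eq C d) /\
  (forall C, irreducible_component Z C -> dim_le C d).

End Zariski.

(* Endomorphisms of V = k^n are matrices acting on column vectors. *)
Section AlgebraWithInvolution.
Variables (k : fieldType) (n : nat).

Definition is_adjoint (f : 'cV[k]_n -> 'cV[k]_n -> k)
    (rho : 'M[k]_n -> 'M[k]_n) : Prop :=
  forall (A : 'M[k]_n) (v w : 'cV[k]_n), f (rho A *m v) w = f v (A *m w).

Variables (r : nat) (rho : 'M[k]_n -> 'M[k]_n).
Implicit Type A : r.-tuple 'M[k]_n.

(* A noncommutative polynomial in x_1, ..., x_r, x_1', ..., x_r' is encoded as
   a list of pairs (coefficient, word); the letter inl i stands for x_i, inr i
   for x_i', and the empty word for the monomial 1. *)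
Definition ncpoly : Type := seq (k * seq ('I_r + 'I_r)).

Definition letter A (x : 'I_r + 'I_r) : 'M[k]_n :=
  match x with inl i => tnth A i | inr i => rho (tnth A i) end.

Definition nceval A (p : ncpoly) : 'M[k]_n :=
  \sum_(t <- p) t.1 *: (\big[mulmx/1%:M]_(x <- t.2) letter A x).

Definition generates A : Prop :=
  forall M : 'M[k]_n, exists p : ncpoly, M = nceval A p.

(* The identification of End(V)^r with the affine space of dimension r n^2. *)
Definition coords A : 'rV[k]_(r * (n * n)) :=
  mxvec (\matrix_(i < r) mxvec (tnth A i)).

Lemma coords_bij : bijective coords.
Proof.
exists (fun x => [tuple vec_mx (row i (vec_mx x)) | i < r]) => [A|x].
  by apply: eq_from_tnth => i; rewrite tnth_mktuple mxvecK rowK mxvecK.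
rewrite /coords -[RHS]vec_mxK; congr mxvec; apply/row_matrixP => i.
by rewrite rowK tnth_mktuple vec_mxK.
Qed.

Definition nongenerating : set 'rV[k]_(r * (n * n)) :=
  coords @` [set A | ~ generates A].

End AlgebraWithInvolution.

Arguments nongenerating {k n} r rho.

(* A nondegenerate form has exactly one adjoint map. *)
Section Adjoint.
Variables (k : fieldType) (n : nat) (f : {skew_symmetric 'cV[k]_n}).
Hypothesis ndf : nondegenerate f.

Let G := \matrix_(i < n, j < n) f (delta_mx i 0) (delta_mx j 0).

Let formE v w : f v w = (v^T *m G *m w) 0 0.
Proof.
have dec u : u = \sum_i u i 0 *: delta_mx i 0 :> 'cV[k]_n.
  by rewrite {1}[u]matrix_sum_delta; apply: eq_bigr => i _; rewrite big_ord1.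
rewrite {1}[w]dec linear_sumr mxE; apply: eq_bigr => j _.
rewrite linearZr_LR /= mulrC; congr (_ * _).
rewrite {1}[v]dec linear_sumlz mxE; apply: eq_bigr => i _.
by rewrite linearZl_LR /= !mxE.
Qed.

Let form_inj v : (forall w, f v w = 0) -> v = 0.
Proof.
move=> v0; apply/eqP; rewrite -memv0 -(eqP ndf).
by apply/mem_orthovP => w _; apply: v0.
Qed.

Let G_unit : G \in unitmx.
Proof.
rewrite -row_free_unit -kermx_eq0; apply/eqP/row_matrixP => i; rewrite row0.
set u := row i _; have uG : u *m G = 0.
  by apply/eqP; rewrite -sub_kermx row_sub.
rewrite -[u]trmxK (form_inj (v := u^T)) ?trmx0 // => w.
by rewrite formE trmxK uG mul0mx mxE.
Qed.

Lemma adjoint_exists : exists rho, is_adjoint f rho.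
Proof.
exists (fun A => (G *m A *m invmx G)^T) => A v w.
by rewrite !formE trmx_mul trmxK !mulmxA mulmxKV.
Qed.

Lemma adjoint_unique rho1 rho2 :
  is_adjoint f rho1 -> is_adjoint f rho2 -> rho1 =1 rho2.
Proof.
move=> h1 h2 A; apply/trmx_inj/row_matrixP => j.
rewrite -!tr_col !colE; congr trmx.
apply/eqP; rewrite -subr_eq0; apply/eqP/form_inj => w.
rewrite linearBl; apply/eqP; rewrite subr_eq0; apply/eqP.
exact: etrans (h1 _ _ _) (esym (h2 _ _ _)).
Qed.

End Adjoint.

(* Main.v *)
Require Import Defs.
From mathcomp Require Import all_boot all_algebra.
From mathcomp Require Import boolp classical_sets.
From mathcomp Require Import mpoly zify.

(** The dimension of a set [Z] is bounded from above by algebraic dependence: if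
    any [T + 1] polynomials are algebraically dependent on [Z], every chain of
    irreducible closed subsets of [Z] has length at most [T], because passing to
    a proper closed subset of an irreducible set saves one polynomial
    ([algdep_proper], [algdep_dim_le]).  The image of a polynomial map in [T]
    variables has this property by counting monomials ([mpoly_algdep]), and it
    passes to finite unions.  Conversely, under this bound, a polynomial map from
    [k ^ T] into [Z] whose differential at the origin is injective provides a
    chain of length [T] and a component of dimension [T]
    ([max_component_dim_immersive]).  So it is enough to cover the nongenerating
    tuples by finitely many parametrized families, and to find an immersed family
    with the largest number of parameters.

    By Burnside's theorem ([burnside]), a tuple [A] is nongenerating if and only
    if the [A_i] and their adjoints have a common proper nonzero invariant
    subspace [W].  The orthogonal space of [W] and its intersection with [W] are
    then invariant too, so [W] can be chosen of dimension [d < n / 2], or of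
    dimension [n / 2] and either Lagrangian or nondegenerate
    ([nongenerates_strata]).  The subspaces of dimension [d] lie in finitely many
    charts of [d (n - d)] parameters.  For a fixed [W], an endomorphism such that
    it and its adjoint preserve [W] is given by its blocks on [W], on the
    quotient by the orthogonal space of [W], and by one more block, that is,
    by at most [2 d ^ 2 + (n - d) ^ 2] parameters ([memberP]).  In the
    nondegenerate case the first two blocks determine each other through the Gram
    matrix of [W], which saves [d ^ 2] parameters for each member of the tuple.
    The Lagrangian subspaces, of dimension [d = n / 2], form a family of
    [d (d + 1) / 2] parameters only, given by symmetric matrices in charts adapted
    to Darboux bases ([algdep_lagrangian_stratum]).

    The number of parameters of the isotropic lines, [d = 1], is the general
    value of the statement.  It dominates the other strata, except the Lagrangian
    one for [n = 4] and [n = 6] ([stratum_dim_le], [nondegenerate_dim_le],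
    [lagrangian_dim_le]); both families are immersed at the tuple of projectors
    onto [W] ([immersive_family]). *)

Set Implicit Arguments.
Unset Strict Implicit.
Unset Printing Implicit Defensive.

Import GRing.Theory.

(** * Polynomial functions *)
Section PolynomialFunctions.
Local Open Scope ring_scope.
Variable k : closedFieldType.

Lemma poly_nonroot (p : {poly k}) : p != 0 -> exists s, p.[s] != 0.
Proof.
move=> p0; apply: contrapT => h.
have {}h s : p.[s] = 0 by apply/eqP/negPn/negP => ps; apply: h; exists s.
have [s] : exists s, root (p * 'X + 1) s.
  apply/closed_rootP; rewrite size_MXaddC (negPf p0) /= eqSS.
  by rewrite size_poly_eq0.
by rewrite rootE !hornerE h mul0r add0r oner_eq0.
Qed.

Lemma poly_punctured_eq0 (p : {poly k}) :
  (forall s, s != 0 -> p.[s] = 0) -> p = 0.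
Proof.
move=> h; apply/eqP; apply: contraT => p0.
have [|s] := @poly_nonroot (p * 'X); first by rewrite mulf_neq0 ?polyX_eq0.
rewrite !hornerE mulf_eq0 negb_or => /andP[ps s0].
by rewrite h ?eqxx in ps.
Qed.

Lemma digits_inj B n (f g : 'I_n -> nat) :
  (forall i, f i < B)%N -> (forall i, g i < B)%N ->
  (\sum_i f i * B ^ i = \sum_i g i * B ^ i)%N -> f =1 g.
Proof.
elim: n f g => [|n IH] f g fB gB; first by move=> _ [].
have E (h : 'I_n.+1 -> nat) : (\sum_i h i * B ^ i =
    (\sum_i h (lift ord0 i) * B ^ i) * B + h ord0)%N.
  rewrite big_ord_recl expn0 muln1 addnC big_distrl; congr addn.
  by apply: eq_bigr => i _; rewrite /= /bump add1n expnSr mulnA.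
rewrite !E => e.
have e0 : f ord0 = g ord0.
  by have := congr1 (modn ^~ B) e; rewrite !modnMDl !modn_small.
have B0 : (0 < B)%N by apply: leq_ltn_trans (fB ord0).
move: e; rewrite e0 => /addIn /eqP; rewrite eqn_pmul2r // => /eqP.
move=> /(IH (f \o lift ord0) (g \o lift ord0) (fun=> fB _) (fun=> gB _)) h i.
by case: (unliftP ord0 i) => [j|] ->; [exact: h | exact: e0].
Qed.

(** Substituting the powers [s ^ (B ^ i)] for the variables turns distinct
    monomials with exponents below [B] into distinct powers of [s]. *)
Lemma mpoly_nonroot n (p : {mpoly k[n]}) : p != 0 -> exists v, p.@[v] != 0.
Proof.
move=> p0; set B := msize p.
pose w (m : 'X_{1..n}) := (\sum_i m i * B ^ i)%N.
pose u := \sum_(m <- msupp p) p@_m *: 'X^(w m) : {poly k}.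
have lt m : m \in msupp p -> forall i, (m i < B)%N.
  move=> mp i; apply: leq_ltn_trans (msize_mdeg_lt mp).
  by rewrite mdegE (bigD1 i) //= leq_addr.
have [|s us] := @poly_nonroot u.
  have l := mlead_supp p0.
  apply: contraNneq p0 => /(congr1 (fun q : {poly k} => q`_(w (mlead p)))).
  rewrite coef0 coef_sum (bigD1_seq _ l (msupp_uniq p)) //= coefZ coefXn.
  rewrite eqxx mulr1 big_seq_cond big1 ?addr0 => [/eqP|m /andP[mp ml]].
    by rewrite mleadc_eq0.
  rewrite coefZ coefXn; case: eqP => [/(digits_inj (lt _ l) (lt _ mp)) e|_].
    by case/eqP: ml; apply/mnmP => i; rewrite e.
  by rewrite mulr0.
exists (fun i => s ^+ (B ^ i)%N); rewrite mevalE.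
suff -> : \sum_(m <- msupp p) p@_m * \prod_(i < n) (s ^+ (B ^ i)%N) ^+ m i =
    u.[s] by [].
rewrite horner_sum; apply: eq_bigr => m _.
rewrite hornerZ hornerXn /w (big_morph (GRing.exp s) (exprD s) (expr0 s)) /=.
congr (_ * _); apply: eq_bigr => i _; by rewrite -exprM mulnC.
Qed.

(** An arbitrary ring [S] of functions serves for the polynomial functions of a
    point and for those of a scalar. *)
Definition funring T (S : (T -> k) -> Prop) :=
  [/\ forall c, S (fun=> c),
      forall f g, S f -> S g -> S (fun x => f x + g x) &
      forall f g, S f -> S g -> S (fun x => f x * g x)].

Definition mxin T (S : (T -> k) -> Prop) p q (M : T -> 'M[k]_(p, q)) :=
  forall i j, S (fun x => M x i j).

Section MatrixEntries.
Variables (T : Type) (S : (T -> k) -> Prop) (HS : funring S).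

Let SC : forall c, S (fun=> c). Proof. by case: HS. Qed.
Let SD f g : S f -> S g -> S (fun x => f x + g x). Proof. by case: HS; auto. Qed.
Let SM f g : S f -> S g -> S (fun x => f x * g x). Proof. by case: HS; auto. Qed.

Lemma funring_ext f g : f =1 g -> S f -> S g.
Proof. by move/funext ->. Qed.

Lemma funring_sum I (r : seq I) (F : I -> T -> k) :
  (forall i, S (F i)) -> S (fun x => \sum_(i <- r) F i x).
Proof.
move=> h; elim: r => [|i r IH].
  by apply: funring_ext (SC 0) => x; rewrite big_nil.
by apply: funring_ext (SD (h i) IH) => x; rewrite big_cons.
Qed.

Lemma mxin_const p q (M : 'M_(p, q)) : mxin S (fun=> M).
Proof. by move=> i j; apply: SC. Qed.

Lemma mxinD p q (M N : T -> 'M_(p, q)) :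
  mxin S M -> mxin S N -> mxin S (fun x => M x + N x).
Proof.
by move=> hM hN i j; apply: funring_ext (SD (hM i j) (hN i j)) => x; rewrite mxE.
Qed.

Lemma mxinZ p q (c : T -> k) (M : T -> 'M_(p, q)) :
  S c -> mxin S M -> mxin S (fun x => c x *: M x).
Proof.
by move=> hc hM i j; apply: funring_ext (SM hc (hM i j)) => x; rewrite mxE.
Qed.

Lemma mxinB p q (M N : T -> 'M_(p, q)) :
  mxin S M -> mxin S N -> mxin S (fun x => M x - N x).
Proof.
move=> hM hN i j; have := SD (hM i j) (SM (SC (-1)) (hN i j)).
by apply: funring_ext => x; rewrite !mxE mulN1r.
Qed.

Lemma mxin_tr p q (M : T -> 'M_(p, q)) : mxin S M -> mxin S (fun x => (M x)^T).
Proof. by move=> hM i j; apply: funring_ext (hM j i) => x; rewrite mxE. Qed.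

Lemma mxinM p q s (M : T -> 'M_(p, q)) (N : T -> 'M_(q, s)) :
  mxin S M -> mxin S N -> mxin S (fun x => M x *m N x).
Proof.
move=> hM hN i j.
have h l : S (fun x => M x i l * N x l j) by apply: SM; [apply: hM|apply: hN].
by apply: funring_ext (funring_sum (index_enum _) h) => x; rewrite mxE.
Qed.

Lemma mxin_vec_mx p q (v : T -> 'rV_(p * q)) :
  mxin S v -> mxin S (fun x => vec_mx (v x)).
Proof.
by move=> h i j; apply: funring_ext (h 0 (mxvec_index i j)) => x; rewrite mxE.
Qed.

Lemma mxin_mxvec p q (M : T -> 'M_(p, q)) :
  mxin S M -> mxin S (fun x => mxvec (M x)).
Proof.
move=> h i j; case/mxvec_indexP: j => a b.
by apply: funring_ext (h a b) => x; rewrite ord1 mxvecE.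
Qed.

Lemma mxin_lsubmx p q s (M : T -> 'M_(p, q + s)) :
  mxin S M -> mxin S (fun x => lsubmx (M x)).
Proof. by move=> h i j; apply: funring_ext (h i (lshift s j)) => x; rewrite mxE. Qed.

Lemma mxin_rsubmx p q s (M : T -> 'M_(p, q + s)) :
  mxin S M -> mxin S (fun x => rsubmx (M x)).
Proof. by move=> h i j; apply: funring_ext (h i (rshift q j)) => x; rewrite mxE. Qed.

Lemma mxin_row_mx p q s (M : T -> 'M_(p, q)) (N : T -> 'M_(p, s)) :
  mxin S M -> mxin S N -> mxin S (fun x => row_mx (M x) (N x)).
Proof.
move=> hM hN i j; case: (split_ordP j) => l ->.
  by apply: funring_ext (hM i l) => x; rewrite row_mxEl.
by apply: funring_ext (hN i l) => x; rewrite row_mxEr.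
Qed.

Lemma mxin_row p q (M : T -> 'M_(p, q)) i :
  mxin S M -> mxin S (fun x => row i (M x)).
Proof. by move=> h a b; apply: funring_ext (h i b) => x; rewrite mxE. Qed.

Lemma mxin_rows p q (v : 'I_p -> T -> 'rV_q) :
  (forall i, mxin S (v i)) -> mxin S (fun x => \matrix_i v i x).
Proof. by move=> h i j; apply: funring_ext (h i 0 j) => x; rewrite mxE. Qed.

End MatrixEntries.

Definition polyfun a (f : 'rV[k]_a -> k) := exists p : {mpoly k[a]},
  forall x, f x = p.@[x 0].

Definition polycurve (f : k -> k) := exists p : {poly k}, forall s, f s = p.[s].

Lemma polyfun_ring a : funring (@polyfun a).
Proof.
split=> [c|f g [p hp] [q hq]|f g [p hp] [q hq]].
- by exists c%:MP => x; rewrite mevalC.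
- by exists (p + q) => x; rewrite mevalD hp hq.
- by exists (p * q) => x; rewrite mevalM hp hq.
Qed.

Lemma polycurve_ring : funring polycurve.
Proof.
split=> [c|f g [p hp] [q hq]|f g [p hp] [q hq]].
- by exists c%:P => s; rewrite hornerC.
- by exists (p + q) => s; rewrite hornerD hp hq.
- by exists (p * q) => s; rewrite hornerM hp hq.
Qed.

Lemma polycurve_id : polycurve id.
Proof. by exists 'X => s; rewrite hornerX. Qed.

Lemma mxin_id a : mxin (@polyfun a) id.
Proof. by move=> i j; exists 'X_j => x; rewrite mevalXU ord1. Qed.

Lemma polyfun_comp a b (f : 'rV[k]_b -> k) (phi : 'rV[k]_a -> 'rV[k]_b) :
  polyfun f -> mxin (@polyfun a) phi -> polyfun (f \o phi).
Proof.
move=> [p hp] hphi.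
have /choice[q hq] j := hphi 0 j.
exists (p \mPo [tuple q j | j < b]) => x /=; rewrite hp comp_mpoly_meval.
by apply: meval_eq => i; rewrite tnth_mktuple hq.
Qed.

End PolynomialFunctions.

(** * Algebraic dependence *)
Section AlgebraicDependence.
Local Open Scope ring_scope.
Variable k : closedFieldType.

Lemma msizeM_leS n (p q : {mpoly k[n]}) d e :
  (msize p <= d.+1 -> msize q <= e.+1 -> msize (p * q) <= (d + e).+1)%N.
Proof.
have [->|p0] := eqVneq p 0; first by rewrite mul0r msize0.
have [->|q0] := eqVneq q 0; first by rewrite mulr0 msize0.
move=> hp hq; rewrite msizeM //.
by have := leq_add hp hq; rewrite addSn addnS; case: (_ + _)%N.
Qed.

Lemma msizeX_le n (p : {mpoly k[n]}) d e :
  (msize p <= d.+1 -> msize (p ^+ e) <= (e * d).+1)%N.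
Proof.
move=> hp; elim: e => [|e IH]; first by rewrite expr0 msize1.
by rewrite exprS mulSn; apply: msizeM_leS.
Qed.

Lemma msize_prod_le n (I : finType) (F : I -> {mpoly k[n]}) (d : I -> nat) :
  (forall i, msize (F i) <= (d i).+1)%N ->
  (msize (\prod_i F i) <= (\sum_i d i).+1)%N.
Proof.
move=> h; elim/big_ind2: _ => [|p d1 q d2|i _]; rewrite ?msize1 //.
exact: msizeM_leS.
Qed.

(** The products of powers of the [q j] with exponents below [B] number
    [B ^ N] and have degree [O(B)], whereas the polynomials of that degree in
    [a] variables form a space of dimension [O(B ^ a)]. *)
Lemma mpoly_algdep a N (q : 'I_N -> {mpoly k[a]}) : (a < N)%N ->
  exists2 P : {mpoly k[N]}, P != 0 & P \mPo [tuple q j | j < N] = 0.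
Proof.
move=> aN; pose D := (\max_j msize (q j))%N.
(* [E <= B * C] and [C ^ a < B] give [E ^ a < B ^ a.+1 <= B ^ N]. *)
pose C := (N * D).+1; pose B := (C ^ a).+1; pose E := (N * (B * D)).+1.
pose I := {ffun 'I_N -> 'I_B}; pose J := {ffun 'I_a -> 'I_E}.
pose mon (i : I) := [multinom (i l : nat) | l < N].
pose f (i : I) := \prod_(l < N) q l ^+ i l.
have fsize i : (msize (f i) <= E)%N.
  apply: leq_trans (@msize_prod_le a _ (fun l => q l ^+ i l) (fun=> B * D)%N _) _.
    move=> l; apply: leq_trans (@msizeX_le _ _ D _ _) _.
      by apply: leqW; apply: (leq_bigmax l).
    by rewrite ltnS leq_mul2r (ltnW (ltn_ord _)) orbT.
  by rewrite sum_nat_const card_ord.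
have lt : (#|J| < #|I|)%N.
  rewrite !card_ffun !card_ord.
  have EC : (E <= B * C)%N.
    by rewrite /E /C mulnS [in leqRHS]mulnC -mulnA [in leqRHS](mulnC D) -addn1
               addnC leq_add2r.
  apply: leq_ltn_trans (_ : _ <= (B * C) ^ a)%N _.
    by case: (posnP a) => [->|?]; rewrite ?expn0 // leq_exp2r.
  apply: leq_trans (_ : B ^ a.+1 <= _)%N; last by rewrite leq_exp2l // ltnS expn_gt0.
  by rewrite expnMn expnS mulnC ltn_pmul2r ?expn_gt0.
pose M : 'M[k]_(#|I|, #|J|) :=
  \matrix_(i, j) (f (enum_val i))@_[multinom ((enum_val j : J) l : nat) | l < a].
have : kermx M != 0.
  rewrite -mxrank_eq0 mxrank_ker subn_eq0 -ltnNge.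
  exact: leq_ltn_trans (rank_leq_col M) lt.
case/rowV0Pn => c /sub_kermxP cM c0.
pose P : {mpoly k[N]} := \sum_(i : I) c 0 (enum_rank i) *: 'X_[mon i].
have Pm i : P@_(mon i) = c 0 (enum_rank i).
  rewrite /P raddf_sum /= (bigD1 i) //= mcoeffZ mcoeffX eqxx mulr1 big1 ?addr0 //.
  move=> j ji; rewrite mcoeffZ mcoeffX; case: eqP => [e|_]; last by rewrite mulr0.
  case/eqP: ji; apply/ffunP => l; apply: val_inj.
  by have := congr1 (fun m : 'X_{1..N} => m l) e; rewrite !mnmE.
exists P.
  apply: contra_neq c0 => P0; apply/rowP => i.
  by rewrite -(enum_valK i) -Pm P0 mcoeff0 mxE.
have -> : P \mPo [tuple q j | j < N] = \sum_(i : I) c 0 (enum_rank i) *: f i.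
  rewrite raddf_sum /=; apply: eq_bigr => i _; rewrite comp_mpolyZ comp_mpolyX.
  by congr (_ *: _); apply: eq_bigr => l _; rewrite tnth_mktuple mnmE.
apply/mpolyP => m; rewrite mcoeff0 raddf_sum /=.
case: (boolP [forall l, (m l < E)%N]) => [/forallP mE|].
  pose j : J := [ffun l => Ordinal (mE l)].
  have := congr1 (fun v : 'rV_ _ => v 0 (enum_rank j)) cM; rewrite !mxE => cMj.
  rewrite (reindex (fun i : 'I_#|I| => enum_val i : I)) /=; last first.
    by exists enum_rank => ? _; rewrite ?enum_rankK ?enum_valK.
  rewrite -[RHS]cMj; apply: eq_bigr => i _; rewrite mcoeffZ !mxE enum_valK.
  congr (_ * mcoeff _ _); apply/mnmP => l.
  by rewrite mnmE enum_rankK ffunE.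
rewrite negb_forall => /existsP[l]; rewrite -leqNgt => ml.
rewrite big1 // => i _; rewrite mcoeffZ memN_msupp_eq0 ?mulr0 //.
apply: msize_mdeg_ge; apply: leq_trans (fsize i) (leq_trans ml _).
by rewrite mdegE (bigD1 l) //= leq_addr.
Qed.

(** Any [N] polynomials are algebraically dependent as functions on [X]: the
    Zariski closure of [X] has dimension less than [N]. *)
Definition algdep m (X : set 'rV[k]_m) N :=
  forall q : 'I_N -> {mpoly k[m]}, exists2 P : {mpoly k[N]},
    P != 0 & forall x, X x -> P.@[fun i => (q i).@[x 0]] = 0.

Section Algdep.
Variable m : nat.
Implicit Types X Y : set 'rV[k]_m.
Local Open Scope classical_set_scope.

Lemma algdep_image a N (phi : 'rV[k]_a -> 'rV[k]_m) :
  mxin (@polyfun k a) phi -> (a < N)%N -> algdep (range phi) N.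
Proof.
move=> hphi aN q.
have /choice[p hp] j : polyfun (fun x => (q j).@[phi x 0]).
  by apply: (polyfun_comp (f := fun y => (q j).@[y 0])) hphi; exists (q j).
have [P P0 hP] := mpoly_algdep p aN.
exists P => // _ [t _ <-].
rewrite -(meval0 (t 0)) -hP comp_mpoly_meval.
by apply: meval_eq => j; rewrite tnth_mktuple hp.
Qed.

Lemma algdepW X Y N : X `<=` Y -> algdep Y N -> algdep X N.
Proof.
by move=> XY hY q; have [P P0 hP] := hY q; exists P => // x /XY; apply: hP.
Qed.

(** A relation between the first [N] of [M] polynomials is a relation between
    all of them. *)
Lemma algdep_leq X N M : (N <= M)%N -> algdep X N -> algdep X M.
Proof.
move=> NM hX q; have [P P0 hP] := hX (fun i => q (widen_ord NM i)).
pose Q := P \mPo [tuple 'X_(widen_ord NM i) | i < N] : {mpoly k[M]}.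
have QE v : Q.@[v] = P.@[fun i => v (widen_ord NM i)].
  rewrite comp_mpoly_meval; apply: meval_eq => i.
  by rewrite tnth_mktuple mevalXU.
exists Q => [|x /hP]; last by rewrite QE.
have [v] := mpoly_nonroot P0; apply: contraNneq => Q0.
pose u (j : 'I_M) := if insub (j : nat) is Some i then v i else 0.
rewrite -[X in _ == X](meval0 u) -Q0 QE; apply/eqP; apply: meval_eq => i.
by rewrite /u /= valK.
Qed.

Lemma algdepU X Y N : algdep X N -> algdep Y N -> algdep (X `|` Y) N.
Proof.
move=> hX hY q; have [P P0 hP] := hX q; have [Q Q0 hQ] := hY q.
exists (P * Q) => [|x]; first by rewrite mulf_neq0.
by rewrite mevalM => -[/hP|/hQ] ->; rewrite ?mul0r ?mulr0.
Qed.

Lemma algdep0 N : algdep (set0 : set 'rV[k]_m) N.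
Proof. by move=> q; exists 1; rewrite ?oner_neq0. Qed.

Lemma algdep_bigU (I : finType) (X : I -> set 'rV[k]_m) N :
  (forall i, algdep (X i) N) -> algdep [set x | exists i, X i x] N.
Proof.
move=> h; apply: (@algdepW _ [set x | exists2 i, i \in enum I & X i x]).
  by move=> x [i Xi]; exists i; rewrite ?mem_enum.
elim: (enum I) => [|i s IH].
  by apply: algdepW (@algdep0 N) => x [i]; rewrite in_nil.
apply: algdepW (algdepU (h i) IH) => x [j].
by rewrite inE => /orP[/eqP -> ?|js ?]; [left | right; exists j].
Qed.

Definition zclosure X : set 'rV[k]_m :=
  [set x | forall p : {mpoly k[m]}, (forall y, X y -> p.@[y 0] = 0) -> p.@[x 0] = 0].

Lemma zclosure_closed X : zclosed (zclosure X).
Proof.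
exists [set p | forall y, X y -> p.@[y 0] = 0].
by apply/seteqP; split=> x.
Qed.

Lemma sub_zclosure X : X `<=` zclosure X.
Proof. by move=> x Xx p; apply. Qed.

Lemma zclosure_min X Y : zclosed Y -> X `<=` Y -> zclosure X `<=` Y.
Proof.
by move=> [S ->] XY x Xx p Sp; apply: Xx => y /XY; apply.
Qed.

Lemma zclosureS X Y : X `<=` Y -> zclosure X `<=` zclosure Y.
Proof.
move=> XY; apply: zclosure_min (zclosure_closed _) _.
exact: subset_trans XY (@sub_zclosure Y).
Qed.

Lemma algdep_zclosure X N : algdep X N -> algdep (zclosure X) N.
Proof.
move=> hX q; have [P P0 hP] := hX q; exists P => // x.
have [p hp] : polyfun (fun x : 'rV[k]_m => P.@[fun i => (q i).@[x 0]]).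
  exists (P \mPo [tuple q j | j < N]) => y; rewrite comp_mpoly_meval.
  by apply: meval_eq => j; rewrite tnth_mktuple.
by rewrite hp; apply=> y /hP; rewrite hp.
Qed.

Lemma zirreducible_mul X p q : zirreducible X ->
  (forall x, X x -> p.@[x 0] * q.@[x 0] = 0) ->
  (forall x, X x -> p.@[x 0] = 0) \/ (forall x, X x -> q.@[x 0] = 0).
Proof.
move=> [_ hX] pq.
pose V (p : {mpoly k[m]}) := [set x : 'rV[k]_m | p.@[x 0] = 0].
have cV p' : zclosed (V p').
  by exists [set p']; apply/seteqP; split=> x /= h; [move=> _ -> | apply: h].
apply: (hX (V p) (V q)) => // x /pq /eqP.
by rewrite mulf_eq0 => /orP[]/eqP; [left | right].
Qed.

(** A polynomial [g] that vanishes on [Y] but not on the irreducible set [X] is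
    added to the given [N] polynomials.  A relation between the [N + 1]
    polynomials on [X], divided by the largest possible power of [g], is
    restricted to [Y], where [g = 0]. *)
Lemma algdep_proper X Y N g : zirreducible X -> Y `<=` X ->
  (forall y, Y y -> g.@[y 0] = 0) -> (exists2 x, X x & g.@[x 0] != 0) ->
  algdep X N.+1 -> algdep Y N.
Proof.
move=> irrX YX gY [x0 Xx0 gx0] hX q.
have [P P0 hP] := hX (fun i => if unlift ord0 i is Some j then q j else g).
have lP := mlead_supp P0.
have [j [m0 m0P m0j] jmin] : exists2 j, exists2 m0, m0 \in msupp P & m0 ord0 = j
    & forall m1, m1 \in msupp P -> (j <= m1 ord0)%N.
  have exj : exists j, has (fun m1 : 'X_{1..N.+1} => m1 ord0 == j) (msupp P).
    by exists (mlead P ord0); apply/hasP; exists (mlead P).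
  exists (ex_minn exj); case: ex_minnP => j /hasP[m1 m1P /eqP e] h.
    by exists m1.
  by move=> m2 m2P; apply: h; apply/hasP; exists m2.
pose tl (m1 : 'X_{1..N.+1}) := [multinom m1 (lift ord0 l) | l < N].
pose W (m1 : 'X_{1..N.+1}) := \prod_(l < N) q l ^+ m1 (lift ord0 l).
pose Q := \sum_(m1 <- msupp P) P@_m1 *: (g ^+ (m1 ord0 - j) * W m1).
have PE x : P.@[fun i => (if unlift ord0 i is Some j then q j else g).@[x 0]] =
    (g ^+ j).@[x 0] * Q.@[x 0].
  rewrite -mevalM mevalE mulr_sumr raddf_sum /= !big_seq.
  apply: eq_bigr => m1 m1P; rewrite -scalerAr mevalZ mulrA -exprD subnKC ?jmin //.
  congr (_ * _); rewrite mevalM rmorphXn rmorph_prod big_ord_recl unlift_none.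
  by congr (_ * _); apply: eq_bigr => l _; rewrite liftK rmorphXn.
have QX x : X x -> Q.@[x 0] = 0.
  have [|h|] := @zirreducible_mul X (g ^+ j) Q irrX; first by move=> y /hP; rewrite PE.
    by have := h _ Xx0; rewrite rmorphXn => /eqP; rewrite expf_eq0 (negPf gx0) andbF.
  exact.
(* [Q] restricted to [Y], where only the terms free of [g] survive. *)
exists (\sum_(m1 <- msupp P | m1 ord0 == j) P@_m1 *: 'X_[tl m1]).
  apply: contraTneq (m0P) => /(congr1 (mcoeff (tl m0))).
  rewrite mcoeff0 raddf_sum /= big_mkcond /= (bigD1_seq m0) ?msupp_uniq //=.
  rewrite m0j eqxx.
  rewrite mcoeffZ mcoeffX eqxx mulr1 big1 ?addr0 => [|m1 m1m0].
    by move/eqP; rewrite mcoeff_eq0.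
  case: (m1 ord0 =P j) => // m1j.
  rewrite mcoeffZ mcoeffX; case: eqP => [e|_]; last by rewrite mulr0.
  case/eqP: m1m0; apply/mnmP => i; case: (unliftP ord0 i) => [l|] ->.
    by have := congr1 (fun m : 'X_{1..N} => m l) e; rewrite !mnmE.
  by rewrite m1j.
move=> y Yy; rewrite -[RHS](QX y (YX _ Yy)) !raddf_sum /= big_mkcond /= !big_seq.
apply: eq_bigr => m1 m1P; rewrite [in RHS]mevalZ mevalM rmorphXn /= gY //.
rewrite expr0n subn_eq0; case: eqVneq => [->|m1j].
  rewrite leqnn mul1r mevalZ mevalX rmorph_prod /=; congr (_ * _).
  by apply: eq_bigr => l _; rewrite mnmE rmorphXn.
have /negPf -> : ~~ (m1 ord0 <= j)%N.
  by rewrite -ltnNge ltn_neqAle eq_sym m1j jmin.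
by rewrite mul0r mulr0.
Qed.

(** Going down a chain of length [d + 1], the allowed number of polynomials drops
    to zero, and no set with a point satisfies a nonzero constant relation. *)
Lemma algdep_dim_le X d : algdep X d.+1 -> dim_le X d.
Proof.
move=> hX e [c [hc cS]]; rewrite leqNgt; apply/negP => de.
suff h i : (i <= d.+1)%N -> algdep (c (d.+1 - i)%N) (d.+1 - i).
  have := h d.+1 (leqnn _); rewrite subnn => h0.
  have [|_ [[x cx] _]] := hc 0%N; first by [].
  have [P P0 /(_ x cx)] := h0 (fun=> 0).
  have [v] := mpoly_nonroot P0.
  rewrite (@meval_eq _ _ v (fun=> (0 : {mpoly k[m]}).@[x 0])); last by case.
  by move/eqP.
elim: i => [_|i IH ile].
  by rewrite subn0; apply: algdepW hX; have [[D _ ->] _] := hc _ de; case=> x [].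
set j := (d.+1 - i.+1)%N.
have Ej : (d.+1 - i = j.+1)%N by rewrite /j subSn // subSS.
have {IH} := IH (ltnW ile); rewrite Ej => IH.
have je : (j < e)%N by apply: leq_ltn_trans _ de; rewrite /j subSS leq_subr.
have [_ irr] := hc j.+1 je; have [[D cD cjE] _] := hc j (ltnW je).
have [sub nsub] := cS j je.
have [x cx ncx] : exists2 x, c j.+1 x & ~ c j x.
  by apply: contrapT => h; apply: nsub => x cx; apply: contrapT => n; apply: h; exists x.
have Xx : X x by have [[D' _ e'] _] := hc j.+1 je; move: cx; rewrite e' => -[].
case: cD => S SE.
have [g Sg gx] : exists2 g, S g & g.@[x 0] != 0.
  apply: contrapT => h; apply: ncx; rewrite cjE SE; split=> // p Sp.
  by apply/eqP/negPn/negP => px; apply: h; exists p.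
apply: (@algdep_proper (c j.+1) _ _ g irr sub) IH; last by exists x.
by move=> y; rewrite cjE SE => -[_]; apply.
Qed.

End Algdep.

End AlgebraicDependence.

(** * The dimension of a parametrized variety *)
Section Immersive.
Local Open Scope ring_scope.
Local Open Scope classical_set_scope.
Variable k : closedFieldType.

(** Some polynomial functions [psi] of the point invert the map to first order at
    the origin.  The expansion is taken along the lines through the origin, so
    that no derivative is needed. *)
Definition immersive a m (phi : 'rV[k]_a -> 'rV[k]_m) :=
  exists (psi : 'rV[k]_m -> 'rV[k]_a) (y : 'rV[k]_a -> k -> 'rV[k]_a),
    [/\ mxin (@polyfun k m) psi, forall t, mxin (@polycurve k) (y t),
        forall t s, psi (phi (s *: t)) = s *: y t s &
        forall t, y t 0 = t].

Lemma immersive_mulmx a b m (phi : 'rV[k]_a -> 'rV[k]_m) (c : 'M_(b, a)) :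
  row_free c -> immersive phi -> immersive (fun t => phi (t *m c)).
Proof.
move=> fc [psi [y [hpsi hy e0 e1]]].
exists (fun x => psi x *m pinvmx c), (fun t s => y (t *m c) s *m pinvmx c).
split=> [|t|t s|t].
- by apply: (mxinM (polyfun_ring k m)) => //; apply: mxin_const; apply: polyfun_ring.
- by apply: (mxinM (polycurve_ring k)) => //; apply: mxin_const; apply: polycurve_ring.
- by rewrite -scalemxAl e0 -scalemxAl.
- by rewrite e1 mulmxKp.
Qed.

(** If the functions [psi] satisfied a relation [P] on the image, the lowest
    homogeneous part of [P] would vanish at every [t], by expansion along the
    line spanned by [t]. *)
Lemma immersive_not_algdep a m (phi : 'rV[k]_a -> 'rV[k]_m) :
  immersive phi -> ~ algdep (range phi) a.
Proof.
move=> [psi [Y [hpsi hY e0 e1]]].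
have /choice[q qE] := hpsi 0.
move=> /(_ q) [P P0 hP].
pose h := mdeg (mlast P).
have hmin mm : mm \in msupp P -> (h <= mdeg mm)%N.
  by move=> mP; apply: lemc_mdeg; apply: mlast_lemc.
have [t] : exists t, (pihomog mdeg h P).@[t] != 0.
  apply: mpoly_nonroot; apply: contraTneq (mlast_supp P0) => e.
  have := congr1 (mcoeff (mlast P)) e; rewrite mcoeff0 pihomogE raddf_sum /=.
  rewrite big_mkcond /= (bigD1_seq (mlast P)) ?msupp_uniq ?mlast_supp //= eqxx.
  rewrite mcoeffZ mcoeffX eqxx mulr1 big1 ?addr0 => [/eqP|i il].
    by rewrite mcoeff_eq0 mlast_supp.
  by case: ifP => // _; rewrite mcoeffZ mcoeffX (negPf il) mulr0.
case/eqP; pose tt := \row_j t j.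
have /choice[y hy] j : polycurve (fun s => Y tt s 0 j) := hY tt 0 j.
(* [P] along the line, divided by the power [s ^ h]. *)
pose G := \sum_(mm <- msupp P) P@_mm *: ('X^(mdeg mm - h) * \prod_j y j ^+ mm j).
have GE s : P.@[fun j => s * (y j).[s]] = s ^+ h * G.[s].
  rewrite mevalE horner_sum mulr_sumr !big_seq; apply: eq_bigr => mm mP.
  rewrite hornerZ hornerM hornerXn mulrCA; congr (_ * _).
  rewrite mulrA -exprD subnKC ?hmin // horner_prod mdegE.
  rewrite (big_morph (GRing.exp s) (exprD s) (expr0 s)) -big_split /=.
  by apply: eq_bigr => j _; rewrite horner_exp exprMn.
have G0 : G = 0.
  apply: poly_punctured_eq0 => s s0.
  have : s ^+ h * G.[s] = 0.
    rewrite -GE -(hP (phi (s *: tt))); last by exists (s *: tt).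
    by apply: meval_eq => j; rewrite -qE e0 mxE hy.
  by move/eqP; rewrite mulf_eq0 expf_eq0 (negPf s0) andbF => /eqP.
have := congr1 (fun p : {poly k} => p.[0]) G0; rewrite /= horner0 => <-.
rewrite horner_sum pihomogE raddf_sum /= big_mkcond /= !big_seq.
apply: eq_bigr => mm mP; rewrite hornerZ hornerM hornerXn expr0n subn_eq0.
case: eqVneq => [->|mh].
  rewrite leqnn mul1r mevalZ mevalX horner_prod; congr (_ * _).
  apply: eq_bigr => j _; by rewrite horner_exp -hy e1 mxE.
have /negPf -> : ~~ (mdeg mm <= h)%N by rewrite -ltnNge ltn_neqAle eq_sym mh hmin.
by rewrite mul0r mulr0.
Qed.

(** Polynomials in [a] variables form a domain. *)
Lemma range_irreducible a m (phi : 'rV[k]_a -> 'rV[k]_m) :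
  mxin (@polyfun k a) phi -> zirreducible (range phi).
Proof.
move=> hphi; split; first by exists (phi 0), 0.
move=> D1 D2 [S1 ->] [S2 ->] sub; apply: contrapT => h.
have ex (S : set {mpoly k[m]}) :
    ~ (range phi `<=` [set x : 'rV[k]_m | forall p, S p -> p.@[x 0] = 0]) ->
    exists2 p : {mpoly k[a]}, p != 0 &
      exists2 p', S p' & forall t : 'rV[k]_a, p.@[t 0] = p'.@[phi t 0].
  move=> nS; apply: contrapT => n; apply: nS => _ [t _ <-] p Sp.
  have [p' hp'] : polyfun (fun t : 'rV[k]_a => p.@[phi t 0]).
    by apply: (polyfun_comp (f := fun y : 'rV[k]_m => p.@[y 0])) hphi; exists p.
  rewrite hp'; have [->|p'0] := eqVneq p' 0; first by rewrite meval0.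
  by case: n; exists p' => //; exists p.
have [p1 p10 [q1 Sq1 pq1]] : exists2 p : {mpoly k[a]}, p != 0 &
    exists2 p', S1 p' & forall t : 'rV[k]_a, p.@[t 0] = p'.@[phi t 0].
  by apply: ex => n; apply: h; left.
have [p2 p20 [q2 Sq2 pq2]] : exists2 p : {mpoly k[a]}, p != 0 &
    exists2 p', S2 p' & forall t : 'rV[k]_a, p.@[t 0] = p'.@[phi t 0].
  by apply: ex => n; apply: h; right.
have [|v] := @mpoly_nonroot _ _ (p1 * p2); first by rewrite mulf_neq0.
case/eqP; have vE : v =1 (\row_j v j) 0 by move=> j; rewrite mxE.
rewrite (meval_eq _ vE) mevalM pq1 pq2.
have [|/(_ _ Sq1) ->|/(_ _ Sq2) ->] := sub (phi (\row_j v j)).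
- by exists (\row_j v j).
- by rewrite mul0r.
- by rewrite mulr0.
Qed.

Lemma zclosure_irreducible m (X Z : set 'rV[k]_m) :
  X `<=` Z -> zirreducible X -> zirreducible (Z `&` zclosure X).
Proof.
move=> XZ [[x Xx] h]; split; first by exists x; split; [apply: XZ|apply: sub_zclosure].
move=> D1 D2 c1 c2 sub.
have [|XD|XD] := h D1 D2 c1 c2.
- by apply: subset_trans sub => y Xy; split; [apply: XZ|apply: sub_zclosure].
- by left=> y [_]; apply: zclosure_min.
- by right=> y [_]; apply: zclosure_min.
Qed.

(** The images of a flag of linear subspaces have closures of all dimensions up
    to [d].  The closure of the whole image is a component: a larger
    irreducible subset would prolong this chain beyond the dimension of [Z]. *)
Lemma max_component_dim_immersive m (Z : set 'rV[k]_m) d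
    (phi : 'rV[k]_d -> 'rV[k]_m) :
  algdep Z d.+1 -> mxin (@polyfun k d) phi -> immersive phi ->
  range phi `<=` Z -> max_component_dim Z d.
Proof.
move=> Zdep hphi iphi subZ.
pose f i (t : 'rV[k]_i) := phi (t *m pid_mx i).
have hf i : mxin (@polyfun k i) (f i).
  move=> a b; apply: (polyfun_comp (f := fun y : 'rV[k]_d => phi y a b)) => //.
  by apply: (mxinM (polyfun_ring k i));
    [exact: mxin_id | apply: mxin_const; exact: polyfun_ring].
have fZ i : range (f i) `<=` Z.
  by move=> _ [t _ <-]; apply: subZ; exists (t *m pid_mx i).
have fS i : (i < d)%N -> range (f i) `<=` range (f i.+1).
  move=> id _ [t _ <-]; exists (t *m pid_mx i) => //.
  by rewrite /f -mulmxA mul_pid_mx (minn_idPl (leqnSn i)) (minn_idPr (leqnSn i)).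
have fi i : (i <= d)%N -> immersive (f i).
  move=> id; apply: immersive_mulmx => //.
  by rewrite /row_free rank_pid_mx.
pose c i := Z `&` zclosure (range (f i)).
have cirr i : zirreducible (c i).
  by apply: zclosure_irreducible; [apply: fZ | apply: range_irreducible].
have cS i : (i < d)%N -> c i `<` c i.+1.
  move=> id; split; first by apply: setIS; apply: zclosureS; apply: fS.
  move=> sub; case: (immersive_not_algdep (fi i.+1 id)).
  have := algdep_zclosure (algdep_image (hf i) (ltnSn i)).
  apply: algdepW; apply: subset_trans (_ : c i.+1 `<=` _).
    by move=> x hx; split; [apply: fZ hx | apply: sub_zclosure].
  by apply: subset_trans sub _ => x [].
have cl i : exists2 D, zclosed D & c i = Z `&` D.
  by exists (zclosure (range (f i))) => //; apply: zclosure_closed.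
have mono i : (i <= d)%N -> c i `<=` c d.
  move=> id; apply: setIS; apply: zclosureS => _ [t _ <-].
  by exists (t *m pid_mx i); rewrite // /f pid_mx_1 mulmx1.
split; last first.
  move=> C [CZ _ _]; apply: algdep_dim_le; exact: algdepW CZ Zdep.
exists (c d); last first.
  split; last by apply: algdep_dim_le; apply: algdepW Zdep => x [].
  exists c; split=> // i id; split=> //.
  exists (zclosure (range (f i))); first exact: zclosure_closed.
  apply/seteqP; split=> x; last by case=> -[].
  by move=> cx; split; [apply: mono id _ cx | case: cx].
split=> [x []//|//|D DZ irrD cD].
apply: contrapT => nD.
(* The chain prolonged by the closure of a larger irreducible set. *)
pose e i := if (i <= d)%N then c i else Z `&` zclosure D.
have : dim_le Z d by apply: algdep_dim_le.
move=> /(_ d.+1); rewrite ltnn => H; suff: false by []. apply: H.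
exists e; split=> i.
  move=> _; rewrite /e; case: ifP => _; split.
  - exact: cl.
  - exact: cirr.
  - by exists (zclosure D) => //; apply: zclosure_closed.
  - exact: zclosure_irreducible.
rewrite ltnS leq_eqVlt => /orP[/eqP ->|id]; last first.
  by rewrite /e id (ltnW id); apply: cS.
rewrite /e leqnn ltnn; split.
  by move=> x cx; split; [case: cx | apply: sub_zclosure; apply: cD].
move=> sub; apply: nD; apply/seteqP; split=> // x Dx; apply: sub.
by split; [apply: DZ | apply: sub_zclosure].
Qed.

End Immersive.

(** * Burnside's theorem *)
Section Burnside.
Local Open Scope ring_scope.
Variable k : closedFieldType.

Lemma prop_ex_minn (P : nat -> Prop) : (exists n, P n) ->
  exists2 n, P n & forall m, P m -> (n <= m)%N.
Proof.
move=> exP; have exb : exists n, `[< P n >] by have [n /asboolP ?] := exP; exists n.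
exists (ex_minn exb); case: ex_minnP => n /asboolP // _ h m Pm.
exact/h/asboolP.
Qed.

(** A subspace of largest rank among those contained in [P] exhausts [P]. *)
Lemma linear_pred_mx p (P : 'rV[k]_p -> Prop) :
  P 0 -> (forall a u v, P u -> P v -> P (a *: u + v)) ->
  exists W : 'M[k]_p, forall v, P v <-> (v <= W)%MS.
Proof.
move=> P0 PZ.
pose Q n := exists2 W : 'M[k]_p, (forall v : 'rV_p, (v <= W)%MS -> P v) &
  \rank W = (p - n)%N.
have [|n [W WP rW] nmin] := @prop_ex_minn Q.
  by exists p, 0 => [v|]; rewrite ?mxrank0 ?subnn // submx0 => /eqP ->.
exists W => v; split=> [Pv|]; last exact: WP.
apply: contraT => vW.
have lt : (W < W + v)%MS.
  rewrite ltmxE addsmxSl; apply: contra vW; apply: submx_trans.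
  exact: addsmxSr.
have := rank_ltmx lt; set r := \rank (W + v)%MS; rewrite rW.
have rp : (r <= p)%N := rank_leq_col _.
have : (n <= p - r)%N.
  apply: nmin; exists (W + v)%MS; last by rewrite subKn.
  move=> u /sub_addsmxP[[a b] /= ->].
  rewrite addrC [b]mx11_scalar mul_scalar_mx; apply: PZ => //.
  by apply: WP; rewrite submxMl.
lia.
Qed.

Variables (n : nat) (S : 'M[k]_n -> Prop).
Hypothesis n0 : (0 < n)%N.
Hypothesis S1 : S 1%:M.
Hypothesis SZD : forall a A B, S A -> S B -> S (a *: A + B).
Hypothesis SM : forall A B, S A -> S B -> S (A *m B).

Let S0 : S 0.
Proof. by have := SZD (-1) S1 S1; rewrite scaleN1r addNr. Qed.

Let SZ a A : S A -> S (a *: A).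
Proof. by move=> /(SZD a)/(_ S0); rewrite addr0. Qed.

Let SB A B : S A -> S B -> S (A - B).
Proof. by move=> hA hB; rewrite -scaleN1r addrC; apply: SZD. Qed.

Let Ssum I (r : seq I) (F : I -> 'M_n) :
  (forall i, S (F i)) -> S (\sum_(i <- r) F i).
Proof.
move=> h; elim/big_ind: _ => // A B hA hB.
by rewrite -[A]scale1r; apply: SZD.
Qed.

Section Irreducible.
Hypothesis irr : forall W : 'M[k]_n,
  (forall A, S A -> (W *m A <= W)%MS) -> W != 0 -> row_full W.

Let orbit (u v : 'rV_n) : u != 0 -> exists2 A, S A & u *m A = v.
Proof.
move=> u0; pose P v := exists2 A, S A & u *m A = v.
have [|a _ _ [A hA <-] [B hB <-]|W WP] := @linear_pred_mx n P.
- by exists 0; rewrite ?mulmx0.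
- by exists (a *: A + B); [apply: SZD | rewrite mulmxDr -scalemxAr].
apply/WP; apply: submx_full; apply: irr.
  move=> A hA; apply/row_subP => i; rewrite row_mul.
  have /WP[B hB <-] : (row i W <= W)%MS by apply: row_sub.
  by apply/WP; exists (B *m A); [apply: SM | rewrite mulmxA].
apply: contraNneq u0 => W0; have /WP : P u by exists 1%:M; rewrite ?mulmx1.
by rewrite W0 submx0.
Qed.

(** The vectors [B c] with [B] in [S] span the space of the columns, since a row
    [y] with [y B c = 0] for all [B] is zero: the rows [y B] fill the whole
    space. *)
Let orbit_col (c a : 'cV_n) : c != 0 -> exists2 B, S B & B *m c = a.
Proof.
move=> c0; pose P v := exists2 B, S B & (B *m c)^T = v.
have [|b _ _ [A hA <-] [B hB <-]|W WP] := @linear_pred_mx n P.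
- by exists 0; rewrite ?mul0mx ?trmx0.
- exists (b *: A + B); first exact: SZD.
  by rewrite mulmxDl -scalemxAl linearP.
suff /(submx_full a^T)/WP[B hB e] : row_full W.
  by exists B => //; apply: trmx_inj.
rewrite -col_leq_rank leqNgt; apply/negP => rW.
have [y y0 yW] : exists2 y : 'rV_n, y != 0 & y *m W^T = 0.
  have : kermx W^T != 0.
    by rewrite -mxrank_eq0 mxrank_ker mxrank_tr subn_eq0 -ltnNge.
  by case/rowV0Pn => y /sub_kermxP ? ?; exists y.
have yc B : S B -> y *m B *m c = 0.
  move=> hB; have /WP/submxP[D hD] : P (B *m c)^T by exists B.
  by rewrite -mulmxA -[B *m c]trmxK hD trmx_mul mulmxA yW mul0mx.
case/eqP: c0; apply/colP => i; rewrite mxE.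
have [B hB yB] := orbit (delta_mx 0 i) y0.
by have := yc _ hB; rewrite yB -rowE => /rowP/(_ 0); rewrite !mxE.
Qed.

(** A nonzero operator [T] of least rank has rank one.  Otherwise some [A]
    satisfies [x1 T A = x2] with [x1 T], [x2 T] independent, and [T A T - l T],
    for an eigenvalue [l] of [A T] on the image of [T], is nonzero of
    smaller rank. *)
Let rank1 : exists2 T, S T & \rank T = 1%N.
Proof.
pose Q r := exists2 T, S T & T != 0 /\ \rank T = r.
have [|r [T hT [T0 rT]] rmin] := @prop_ex_minn Q.
  exists (\rank (1%:M : 'M[k]_n)), 1%:M => //; split=> //.
  by rewrite -mxrank_eq0 mxrank1 -lt0n.
exists T => //; apply/eqP; rewrite eqn_leq lt0n mxrank_eq0 T0 andbT leqNgt.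
apply/negP => r2.
have [b [bT bfree]] : exists b : 'M_(\rank T, n), (b :=: T)%MS /\ row_free b.
  by exists (row_base T); split; [apply: eq_row_base | apply: row_base_free].
pose x1 := row (Ordinal (ltnW r2)) b; pose x2 := row (Ordinal r2) b.
have binj (u : 'rV_(\rank T)) : u *m b = 0 -> u = 0.
  by move/(congr1 (mulmx^~ (pinvmx b))); rewrite /= mul0mx mulmxKp.
have x12 (a : k) : x2 - a *: x1 != 0.
  rewrite /x1 /x2 !rowE scalemxAl -mulmxBl; apply/negP => /eqP/binj.
  by move/rowP/(_ (Ordinal r2)); rewrite !mxE !eqxx mulr0 subr0 => /eqP; rewrite oner_eq0.
have x10 : x1 != 0.
  rewrite /x1 rowE; apply/negP => /eqP/binj.
  by move/rowP/(_ (Ordinal (ltnW r2))); rewrite !mxE !eqxx => /eqP; rewrite oner_eq0.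
have ex x : (x <= T)%MS -> exists z : 'rV_n, x = z *m T.
  by move/submxP.
have [z1 e1] : exists z : 'rV_n, x1 = z *m T by apply: ex; rewrite -bT row_sub.
have [z2 e2] : exists z : 'rV_n, x2 = z *m T by apply: ex; rewrite -bT row_sub.
have [A hA x1A] := orbit z2 x10.
have /submxP[M bM] : (b *m A *m T <= b)%MS by rewrite bT submxMl.
have [l /eigenvalueP[y yM y0]] : exists l, eigenvalue M l.
  have /closed_rootP[l hl] : size (char_poly M) != 1%N.
    by rewrite size_char_poly eqSS -lt0n (ltnW r2).
  by exists l; rewrite eigenvalue_root_char.
pose T' := T *m (A *m T - l%:M).
have T'E : T' = T *m A *m T - l *: T.
  by rewrite /T' mulmxBr mulmxA mul_mx_scalar.
have : (r <= \rank T')%N.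
  apply: rmin; exists T'.
    by rewrite T'E; apply: SB; [apply: SM => //; apply: SM | apply: SZ].
  split=> //; apply: contra_neq (x12 l) => e; have := congr1 (mulmx z1) e.
  by rewrite mulmx0 T'E mulmxBr -scalemxAr !mulmxA -e1 x1A -e2.
rewrite -rT -(mxrank_mul_ker T (A *m T - l%:M)) -/T' -[leqRHS]addn0 leq_add2l.
rewrite leqn0 mxrank_eq0 => /eqP e.
have : (y *m b <= T :&: kermx (A *m T - l%:M))%MS.
  rewrite sub_capmx -bT submxMl; apply/sub_kermxP.
  rewrite mulmxBr !mulmxA -[y *m b *m A]mulmxA -[y *m _ *m T]mulmxA bM mulmxA yM.
  by rewrite mul_mx_scalar -scalemxAl subrr.
by rewrite e submx0 => /eqP/binj y00; rewrite y00 eqxx in y0.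
Qed.

(** With [T = c d] of rank one, [B T A = (B c) (d A)]. *)
Let outer (a : 'cV_n) (b : 'rV_n) : S (a *m b).
Proof.
have [T hT rT] := rank1.
have [c [d [c0 d0 TE]]] : exists (c : 'cV_n) (d : 'rV_n),
    [/\ c != 0, d != 0 & T = c *m d].
  have := mulmx_base T; move: (col_base T) (row_base T); rewrite rT => c d TE.
  exists c, d; split=> //; apply/eqP => z; move: TE rT; rewrite z.
    by rewrite mul0mx => <-; rewrite mxrank0.
  by rewrite mulmx0 => <-; rewrite mxrank0.
have [A hA <-] := orbit b d0; have [B hB <-] := orbit_col a c0.
by rewrite mulmxA -(mulmxA B) -TE; apply: SM => //; apply: SM.
Qed.

Lemma irreducible_full M : S M.
Proof.
rewrite [M]matrix_sum_delta; apply: Ssum => i; apply: Ssum => j; apply: SZ.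
by rewrite -(mul_delta_mx (0 : 'I_1)); apply: outer.
Qed.

End Irreducible.

(** Following Lomonosov and Rosenthal: an irreducible algebra contains a rank one
    operator, hence all of them, and these span the matrices. *)
Lemma burnside : ~ (forall M, S M) -> exists W : 'M[k]_n,
  [/\ forall A, S A -> (W *m A <= W)%MS, W != 0 & ~~ row_full W].
Proof.
move=> nS; apply: contrapT => h; apply: nS; apply: irreducible_full => W hW W0.
by apply: contrapT => /negP fW; apply: h; exists W.
Qed.

End Burnside.

Section GeneratedAlgebra.
Local Open Scope ring_scope.
Variables (k : closedFieldType) (n r : nat) (rho : 'M[k]_n -> 'M[k]_n).
Implicit Type A : r.-tuple 'M[k]_n.

Lemma nongenerates_invariant A : (0 < n)%N -> ~ generates rho A ->
  exists W : 'M[k]_n, [/\ W != 0, ~~ row_full W &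
    forall x, (W *m letter rho A x <= W)%MS].
Proof.
move=> n0 nA; pose S M := exists p : ncpoly k r, M = nceval rho A p.
have one w : S (\big[mulmx/1%:M]_(x <- w) letter rho A x).
  by exists [:: (1, w)]; rewrite /nceval big_seq1 scale1r.
have [| | | |W [hW W0 fW]] := @burnside k n S n0.
- by have := one [::]; rewrite big_nil.
- move=> a _ _ [p ->] [q ->]; exists ([seq (a * t.1, t.2) | t <- p] ++ q).
  rewrite /nceval big_cat /= big_map scaler_sumr; congr (_ + _).
  by apply: eq_bigr => t _; rewrite scalerA.
- move=> _ _ [p ->] [q ->].
  exists [seq (s.1 * t.1, s.2 ++ t.2) | s <- p, t <- q].
  rewrite /nceval big_allpairs_dep mulmx_suml; apply: eq_bigr => s _.
  rewrite mulmx_sumr; apply: eq_bigr => t _ /=.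
  rewrite -scalemxAl -scalemxAr scalerA; congr (_ *: _).
  elim: s.2 => [|x w IH]; first by rewrite big_nil mul1mx.
  by rewrite cat_cons !big_cons -mulmxA IH.
- by move=> h; apply: nA => M; apply: h.
exists W; split=> // x; apply: hW.
by have := one [:: x]; rewrite big_cons big_nil mulmx1.
Qed.

Lemma invariant_nongenerates A (W : 'M[k]_n) : W != 0 -> ~~ row_full W ->
  (forall x, (W *m letter rho A x <= W)%MS) -> ~ generates rho A.
Proof.
move=> W0 fW hW gA.
have inv M : (W *m M <= W)%MS.
  have [p ->] := gA M; rewrite /nceval mulmx_sumr; apply: summx_sub => t _.
  rewrite -scalemxAr; apply: scalemx_sub.
  elim: t.2 => [|x w IH]; first by rewrite big_nil mulmx1.
  by rewrite big_cons mulmxA; apply: submx_trans (submxMr _ (hW x)) IH.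
have [i [j Wij]] : exists i j, W i j != 0.
  apply: contrapT => h; case/eqP: W0; apply/matrixP => i j; rewrite mxE.
  by apply/eqP/negPn/negP => w; apply: h; exists i, j.
case/negP: fW; rewrite -sub1mx; apply/row_subP => l.
have -> : row l 1%:M = (W i j)^-1 *: (row i W *m delta_mx j l).
  apply/rowP => c; rewrite !mxE (bigD1 j) //= big1 => [|j' jj'].
    by rewrite addr0 !mxE eqxx eq_sym mulrA mulVf // mul1r.
  by rewrite !mxE (negPf jj') mulr0.
apply: scalemx_sub; apply: submx_trans (inv (delta_mx j l)).
by apply: submxMr; apply: row_sub.
Qed.

End GeneratedAlgebra.

(** * Parametrized families of tuples with an invariant subspace *)
Section Charts.
Local Open Scope ring_scope.
Variables (k : closedFieldType) (n : nat).

(** A basis of the row space in two blocks [F], [F'], with its dual basis [E],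
    [E']; the subspaces of the chart are the graphs of the maps from the span of
    [F] to that of [F']. *)
Record chart d e := Chart {
  chF : 'M[k]_(d, n); chF' : 'M[k]_(e, n);
  chE : 'M[k]_(n, d); chE' : 'M[k]_(n, e);
  chFE : chF *m chE = 1%:M; chFE' : chF *m chE' = 0;
  chF'E : chF' *m chE = 0; chF'E' : chF' *m chE' = 1%:M;
  chEF : chE *m chF + chE' *m chF' = 1%:M }.

(** The blocks [E'] and [F'] come from a rank factorization of the projector
    [1 - E F]. *)
Lemma chart_exists d e (F : 'M[k]_(d, n)) (E : 'M_(n, d)) :
  n = (d + e)%N -> F *m E = 1%:M ->
  exists c : chart d e, chF c = F /\ chE c = E.
Proof.
move=> nde FE; pose Pi := 1%:M - E *m F.
have PiE : Pi *m E = 0 by rewrite mulmxBl mul1mx -mulmxA FE mulmx1 subrr.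
have FPi : F *m Pi = 0 by rewrite mulmxBr mulmx1 mulmxA FE mul1mx subrr.
have rE : \rank E = d.
  apply/eqP; rewrite eqn_leq rank_leq_col /=.
  by rewrite -[leqLHS](mxrank1 k) -FE mxrankM_maxr.
have rPi : \rank Pi = e.
  have u : (\rank Pi + \rank E <= n)%N.
    have := mxrank_mul_ker Pi E; rewrite PiE mxrank0 add0n => <-.
    have := mxrankS (capmxSr Pi (kermx E)); rewrite mxrank_ker.
    by have := rank_leq_row E; lia.
  have l : (n <= \rank Pi + d)%N.
    rewrite -[leqLHS](mxrank1 k) -(subrK (E *m F) 1%:M) -/Pi.
    apply: leq_trans (mxrank_add _ _) _; rewrite leq_add2l.
    exact: leq_trans (mxrankM_maxl _ _) (rank_leq_col _).
  by lia.
have := mulmx_base Pi; have := row_base_free Pi; have := col_base_full Pi.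
move: (col_base Pi) (row_base Pi); rewrite rPi => E' F' fE' fF' EF'.
have cE' p (M N : 'M_(e, p)) : E' *m M = E' *m N -> M = N.
  have /row_fullP[Q QE] := fE'; move/(congr1 (mulmx Q)).
  by rewrite !mulmxA QE !mul1mx.
have cF' p (M N : 'M_(p, e)) : M *m F' = N *m F' -> M = N.
  by move/(congr1 (mulmx^~ (pinvmx F'))); rewrite !mulmxKp.
have F'E : F' *m E = 0 by apply: cE'; rewrite mulmxA EF' PiE mulmx0.
have FE' : F *m E' = 0 by apply: cF'; rewrite -mulmxA EF' FPi mul0mx.
have F'E' : F' *m E' = 1%:M.
  apply: cF'; rewrite -mulmxA EF' mul1mx mulmxBr mulmx1 mulmxA F'E mul0mx.
  by rewrite subr0.
have EF : E *m F + E' *m F' = 1%:M by rewrite EF' addrC subrK.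
by exists (Chart FE FE' F'E F'E' EF).
Qed.

End Charts.

Section Families.
Local Open Scope ring_scope.
Local Open Scope classical_set_scope.
Variables (k : closedFieldType) (n : nat) (H : 'M[k]_n).
Hypothesis H_unit : H \in unitmx.

(** The second equation, transposed, says that the adjoint [H A^T H^-1] preserves
    the row space of [w]. *)
Definition stabilizes d (w : 'M[k]_(d, n)) (A : 'M[k]_n) :=
  exists L R : 'M[k]_d, w *m A = L *m w /\ A *m H *m w^T = H *m w^T *m R.

Lemma stabilizes_gauge d (g : 'M_d) (w : 'M[k]_(d, n)) A :
  g \in unitmx -> stabilizes w A -> stabilizes (g *m w) A.
Proof.
move=> gu [L [R [e1 e2]]].
exists (g *m L *m invmx g), (invmx g^T *m R *m g^T); split.
  by rewrite -!mulmxA e1 mulKmx.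
by rewrite trmx_mul !mulmxA mulmxK ?unitmx_tr // e2.
Qed.

Section Member.
Variables (d e : nat) (c : chart k n d e).
Let F := chF c. Let F' := chF' c. Let E := chE c. Let E' := chE' c.

Definition chart_row (X : 'M[k]_(d, e)) := chF c + X *m chF' c.

Lemma chart_rowE X : chart_row X *m E = 1%:M.
Proof. by rewrite mulmxDl chFE -mulmxA chF'E mulmx0 addr0. Qed.

Lemma chart_rowP (w : 'M_(d, n)) : w *m E \in unitmx ->
  exists X, invmx (w *m E) *m w = chart_row X.
Proof.
move=> u; exists (invmx (w *m E) *m w *m E').
by rewrite -[LHS]mulmx1 -(chEF c) mulmxDr !mulmxA -(mulmxA _ w E) mulVmx // mul1mx.
Qed.

(** A basis of the space of the column vectors [v] with [chart_row X *m v = 0]. *)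
Definition chart_ker (X : 'M[k]_(d, e)) := chE' c - chE c *m X.

Lemma chart_rowK X : chart_row X *m chart_ker X = 0.
Proof.
rewrite mulmxDl !mulmxBr chFE' mulmxA chFE mul1mx -!mulmxA chF'E' mulmx1.
by rewrite [chF' c *m (_ *m _)]mulmxA chF'E mul0mx mulmx0 subr0 add0r addNr.
Qed.

Lemma chart_kerP X p (B : 'M_(n, p)) : chart_row X *m B = 0 ->
  B = chart_ker X *m (F' *m B).
Proof.
rewrite mulmxDl => /eqP; rewrite addr_eq0 => /eqP FB.
rewrite mulmxBl -{1}[B]mul1mx -(chEF c) mulmxDl -!mulmxA FB.
by rewrite mulmxN addrC -!mulmxA.
Qed.

Lemma chart_kerP2 X (B : 'M_n) :
  chart_row X *m B = 0 -> B *m (chart_row X)^T = 0 ->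
  B = chart_ker X *m (F' *m B *m F'^T) *m (chart_ker X)^T.
Proof.
move=> wB Bw; have BD : chart_row X *m B^T = 0.
  by rewrite -[chart_row X]trmxK -trmx_mul Bw trmx0.
have /(congr1 trmx) := chart_kerP BD; rewrite trmxK trmx_mul trmx_mul trmxK => B1.
by rewrite -!mulmxA [B *m (_ *m _)]mulmxA -B1 -(chart_kerP wB).
Qed.

(** Here [L] is the action on the row space of [w], [R] the transposed action of
    the adjoint, and [D] the remaining block, killed by [w] on the left and by
    [H w^T] on the right. *)
Definition member X (L R : 'M[k]_d) (D : 'M[k]_e) : 'M[k]_n :=
  let w := chart_row X in
  chE c *m L *m w + (1%:M - chE c *m w) *m H *m w^T *m R *m (chE c)^T *m invmx H
  + chart_ker X *m D *m (chart_ker X)^T *m invmx H.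

(** Subtracting the two terms that carry [L] and [R] leaves a matrix annihilated
    by [w] on the left and by [H w^T] on the right; the compatibility
    [L K = K R] with [K = w H w^T] makes the two terms cancel on the overlap. *)
Lemma memberP X A L R :
  chart_row X *m A = L *m chart_row X ->
  A *m H *m (chart_row X)^T = H *m (chart_row X)^T *m R ->
  exists D, A = member X L R D.
Proof.
set w := chart_row X => wA AH.
pose y := (1%:M - E *m w) *m H *m w^T *m R *m E^T *m invmx H.
pose A' := A - E *m L *m w - y.
pose B := A' *m H.
have wE : w *m E = 1%:M := chart_rowE X.
have wP : w *m (1%:M - E *m w) = 0.
  by rewrite mulmxBr mulmx1 mulmxA wE mul1mx subrr.
have wA' : w *m A' = 0.
  by rewrite /A' !mulmxBr /y !mulmxA wE wA mul1mx subrr sub0r wP !mul0mx oppr0.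
have Ew : E^T *m w^T = 1%:M by rewrite -trmx_mul wE trmx1.
have LKR : L *m w *m H *m w^T = w *m H *m w^T *m R.
  by have := congr1 (mulmx w) AH; rewrite !mulmxA wA.
have A'w : B *m w^T = 0.
  have e1 : y *m H *m w^T =
      H *m w^T *m R - E *m L *m w *m H *m w^T.
    rewrite /y mulmxKV // -[_ *m E^T *m _]mulmxA Ew mulmx1 -!mulmxA in LKR *.
    by rewrite LKR mulmxBl mul1mx -!mulmxA.
  by rewrite /B /A' !mulmxBl e1 AH subrr.
have wB : w *m B = 0 by rewrite mulmxA wA' mul0mx.
exists (F' *m B *m F'^T).
rewrite /member -(chart_kerP2 wB A'w) -/w /B mulmxK // /A' -/E -/y.
by rewrite [RHS]addrC -[A - _ - y]addrA -opprD subrK.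
Qed.

(** For an isotropic [w] the blocks [L] and [R] are independent. *)
Lemma member_stabilizes X L R D :
  chart_row X *m H *m (chart_row X)^T = 0 ->
  stabilizes (chart_row X) (member X L R D).
Proof.
rewrite /member; have := chart_rowE X; have := chart_rowK X.
move: (chart_row X) (chart_ker X) => w K wK wE iso; exists L, R.
have P1 : w *m (1%:M - chE c *m w) = 0.
  by rewrite mulmxBr mulmx1 mulmxA wE mul1mx subrr.
split; first by rewrite !mulmxDr !mulmxA wE P1 wK !mul0mx !addr0 mul1mx.
rewrite !mulmxDl !mulmxKV // -!(mulmxA _ _ w^T) -!trmx_mul wE wK.
rewrite trmx0 trmx1 !mulmx0 addr0 -!mulmxA.
have iso1 : w *m (H *m w^T) = 0 by rewrite mulmxA.
have iso2 : w *m (H *m (w^T *m R)) = 0 by rewrite !mulmxA iso mul0mx.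
by rewrite iso1 mulmx1 mul1mx mulNmx -mulmxA iso2 !mulmx0 oppr0 addr0 add0r.
Qed.

End Member.

Lemma coordsK r (A : r.-tuple 'M[k]_n) i :
  vec_mx (row i (vec_mx (coords A))) = tnth A i.
Proof. by rewrite /coords mxvecK rowK mxvecK. Qed.

Section Polynomial.
Variables (T : Type) (S : (T -> k) -> Prop) (HS : funring S).
Variables (d e : nat) (c : chart k n d e).

Lemma mxin_chart_row X : mxin S X -> mxin S (fun x => chart_row c (X x)).
Proof.
move=> hX; apply: mxinD => //; first exact: mxin_const.
by apply: mxinM => //; apply: mxin_const.
Qed.

Lemma mxin_chart_ker X : mxin S X -> mxin S (fun x => chart_ker c (X x)).
Proof.
move=> hX; apply: mxinB => //; first exact: mxin_const.
by apply: mxinM => //; apply: mxin_const.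
Qed.

Lemma mxin_member X L R D : mxin S X -> mxin S L -> mxin S R -> mxin S D ->
  mxin S (fun x => member c (X x) (L x) (R x) (D x)).
Proof.
move=> hX hL hR hD; have hw := mxin_chart_row hX; have hK := mxin_chart_ker hX.
have hC p q (M : 'M_(p, q)) : mxin S (fun=> M) by apply: mxin_const.
have hM := @mxinM _ _ _ HS; have hT := @mxin_tr _ _ S.
apply: (mxinD HS); first apply: (mxinD HS).
- by apply: (hM) hw; apply: (hM) hL.
- apply: (hM) (hC _ _ _); apply: (hM) (hC _ _ _); apply: (hM) hR.
  apply: (hM) (hT _ _ _ hw); apply: (hM) (hC _ _ _).
  by apply: (mxinB HS) => //; apply: (hM) hw.
- apply: (hM) (hC _ _ _); apply: (hM) (hT _ _ _ hK); exact: (hM) hD.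
Qed.

Lemma mxin_coords r (A : 'I_r -> T -> 'M[k]_n) : (forall i, mxin S (A i)) ->
  mxin S (fun x => coords [tuple A i x | i < r]).
Proof.
move=> hA; have := mxin_mxvec (mxin_rows (fun i => mxin_mxvec (hA i))).
rewrite /coords; congr mxin; apply/funext => x; congr mxvec.
by apply/matrixP => i j; rewrite !mxE tnth_mktuple.
Qed.

End Polynomial.

Section Family.
Variables (r a d e : nat) (c : chart k n d e) (B : 'M[k]_(a, d * e)).
Let N := (a + r * (d * d + (d * d + e * e)))%N.
Implicit Type t : 'rV[k]_N.

Definition parX t : 'M[k]_(d, e) := vec_mx (lsubmx t *m B).
Definition parrow t i : 'rV[k]_(d * d + (d * d + e * e)) :=
  row i (vec_mx (rsubmx t)).
Definition parL t i : 'M[k]_d := vec_mx (lsubmx (parrow t i)).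
Definition parR t i : 'M[k]_d := vec_mx (lsubmx (rsubmx (parrow t i))).
Definition parD t i : 'M[k]_e := vec_mx (rsubmx (rsubmx (parrow t i))).

(** The parameters: the coordinates of [X], then the blocks [L], [R], [D] of each
    member of the tuple. *)
Definition pack (u : 'rV[k]_a) (L R : 'I_r -> 'M[k]_d) (D : 'I_r -> 'M[k]_e) :
    'rV[k]_N :=
  row_mx u (mxvec (\matrix_i row_mx (mxvec (L i))
                                    (row_mx (mxvec (R i)) (mxvec (D i))))).

Lemma parX_pack u L R D : parX (pack u L R D) = vec_mx (u *m B).
Proof. by rewrite /parX row_mxKl. Qed.

Lemma parrow_pack u L R D i : parrow (pack u L R D) i =
  row_mx (mxvec (L i)) (row_mx (mxvec (R i)) (mxvec (D i))).
Proof. by rewrite /parrow row_mxKr mxvecK rowK. Qed.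

Lemma parL_pack u L R D i : parL (pack u L R D) i = L i.
Proof. by rewrite /parL parrow_pack row_mxKl mxvecK. Qed.

Lemma parR_pack u L R D i : parR (pack u L R D) i = R i.
Proof. by rewrite /parR parrow_pack row_mxKr row_mxKl mxvecK. Qed.

Lemma parD_pack u L R D i : parD (pack u L R D) i = D i.
Proof. by rewrite /parD parrow_pack !row_mxKr mxvecK. Qed.

Lemma packK t : pack (lsubmx t) (parL t) (parR t) (parD t) = t.
Proof.
rewrite /pack -[RHS]hsubmxK; congr row_mx; rewrite -[RHS]vec_mxK; congr mxvec.
by apply/row_matrixP => i; rewrite rowK !vec_mxK !hsubmxK.
Qed.

Lemma packZ s u L R D :
  pack (s *: u) (fun i => s *: L i) (fun i => s *: R i) (fun i => s *: D i) =
  s *: pack u L R D.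
Proof.
rewrite /pack scale_row_mx -linearZ; congr row_mx; congr mxvec.
by apply/row_matrixP => i; rewrite [RHS]linearZ /= !rowK !scale_row_mx !linearZ.
Qed.

Lemma parXZ s t : parX (s *: t) = s *: parX t.
Proof. by rewrite /parX linearZ -scalemxAl linearZ. Qed.

Lemma parrowZ s t i : parrow (s *: t) i = s *: parrow t i.
Proof. by rewrite /parrow !linearZ. Qed.

Lemma parLZ s t i : parL (s *: t) i = s *: parL t i.
Proof. by rewrite /parL parrowZ !linearZ. Qed.

Lemma parRZ s t i : parR (s *: t) i = s *: parR t i.
Proof. by rewrite /parR parrowZ !linearZ. Qed.

Lemma parDZ s t i : parD (s *: t) i = s *: parD t i.
Proof. by rewrite /parD parrowZ !linearZ. Qed.

Section PackPolynomial.
Variables (T : Type) (S : (T -> k) -> Prop) (HS : funring S).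

Lemma mxin_pack u L R D : mxin S u -> (forall i, mxin S (L ^~ i)) ->
  (forall i, mxin S (R ^~ i)) -> (forall i, mxin S (D ^~ i)) ->
  mxin S (fun x : T => pack (u x) (L x) (R x) (D x)).
Proof.
move=> hu hL hR hD; apply: mxin_row_mx => //; apply: mxin_mxvec.
apply: mxin_rows => i; apply: mxin_row_mx; first exact: mxin_mxvec.
by apply: mxin_row_mx; apply: mxin_mxvec.
Qed.

End PackPolynomial.

(** Tuples stabilizing [chart_row X], where [X] runs through the linear space
    spanned by the rows of [B].  The shift of the block [L] by the identity moves
    the origin to the tuple of the projectors [E F]. *)
Definition family t : r.-tuple 'M[k]_n :=
  [tuple member c (parX t) (1%:M + parL t i) (parR t i) (parD t i) | i < r].

Lemma mxin_family : mxin (@polyfun k N) (fun t => coords (family t)).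
Proof.
have HS := @polyfun_ring k N; have hid := @mxin_id k N.
have hC p q (M : 'M_(p, q)) : mxin (@polyfun k N) (fun=> M) by apply: mxin_const.
have hrow i : mxin (@polyfun k N) (parrow^~ i).
  by apply: mxin_row; apply: mxin_vec_mx; apply: mxin_rsubmx.
apply: mxin_coords => i; apply: mxin_member => //.
- by apply: mxin_vec_mx; apply: (mxinM HS) => //; apply: mxin_lsubmx.
- by apply: (mxinD HS) => //; apply: mxin_vec_mx; apply: mxin_lsubmx.
- by apply: mxin_vec_mx; apply: mxin_lsubmx; apply: mxin_rsubmx.
- by apply: mxin_vec_mx; apply: mxin_rsubmx; apply: mxin_rsubmx.
Qed.

Lemma algdep_family :
  algdep (@coords k n r @` [set A | exists u, forall i,
      stabilizes (chart_row c (vec_mx (u *m B))) (tnth A i)]) N.+1.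
Proof.
apply: algdepW (algdep_image mxin_family (ltnSn N)) => _ [A [u hA] <-].
have /choice[p hp] i : exists p : 'M_d * 'M_d * 'M_e,
    tnth A i = member c (vec_mx (u *m B)) p.1.1 p.1.2 p.2.
  by have [L [R [e1 e2]]] := hA i; have [D ->] := memberP e1 e2; exists (L, R, D).
exists (pack u (fun i => (p i).1.1 - 1%:M) (fun i => (p i).1.2) (fun i => (p i).2)) => //.
congr coords; apply: eq_from_tnth => i.
by rewrite tnth_mktuple parX_pack parL_pack parR_pack parD_pack addrC subrK -hp.
Qed.

(** The difference quotient of the family along the line spanned by [t]. *)
Definition tangent t s i : 'M[k]_n :=
  let w := chart_row c (s *: parX t) in
  let K := chart_ker c (s *: parX t) in
  chE c *m parX t *m chF' c + chE c *m parL t i *m w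
  + (1%:M - chE c *m w) *m H *m w^T *m parR t i *m (chE c)^T *m invmx H
  + K *m parD t i *m K^T *m invmx H.

Lemma family_tangent t s i :
  tnth (family (s *: t)) i = chE c *m chF c + s *: tangent t s i.
Proof.
rewrite tnth_mktuple /member parXZ parLZ parRZ parDZ /tangent.
set w := chart_row c _; set K := chart_ker c _.
rewrite !scalerDr !addrA; congr (_ + _ + _).
- rewrite mulmxDr mulmx1 mulmxDl {1}/w /chart_row mulmxDr.
  by rewrite -!scalemxAl -!scalemxAr -!scalemxAl mulmxA.
- by rewrite -!scalemxAr -!scalemxAl.
- by rewrite -!scalemxAr -!scalemxAl.
Qed.

(** At the origin the tangent vector is
    [E X F' + E L F + H F^T R E^T H^-1 + E' D E'^T H^-1], from which the parameters
    are read off with the dual bases.  Since [F] is isotropic, [F] kills the last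
    two terms, and [E^T H^-1 E' F'] is a left inverse of [H F^T]. *)
Lemma immersive_family (hr : (0 < r)%N) : row_free B ->
  chF c *m H *m (chF c)^T = 0 -> immersive (fun t => coords (family t)).
Proof.
move=> fB iso.
pose F := chF c; pose F' := chF' c; pose E := chE c; pose E' := chE' c.
pose ext (A : 'I_r -> 'M[k]_n) := pack
  (mxvec (F *m A (Ordinal hr) *m E') *m pinvmx B)
  (fun i => F *m A i *m E)
  (fun i => E^T *m invmx H *m E' *m F' *m A i *m H *m F^T)
  (fun i => F' *m A i *m H *m F'^T).
have extZ s A : ext (fun i => s *: A i) = s *: ext A.
  rewrite -packZ; congr pack; last 3 first.
  - by apply/funext => i; rewrite -!(scalemxAr, scalemxAl).
  - by apply/funext => i; rewrite -!(scalemxAr, scalemxAl).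
  - by apply/funext => i; rewrite -!(scalemxAr, scalemxAl).
  by rewrite -scalemxAr -scalemxAl linearZ /= -scalemxAl.
have ext_in T (S : (T -> k) -> Prop) (HS : funring S) (A : T -> 'I_r -> 'M_n) :
    (forall i, mxin S (A ^~ i)) -> mxin S (fun x => ext (A x)).
  move=> hA; have hC p q (M : 'M_(p, q)) : mxin S (fun=> M) by apply: mxin_const.
  have hM p q s (M1 : T -> 'M_(p, q)) (M2 : 'M_(q, s)) :
      mxin S M1 -> mxin S (fun x => M1 x *m M2).
    by move=> h1; apply: (mxinM HS).
  apply: mxin_pack => [|i|i|i].
  - apply: (hM); apply: mxin_mxvec; apply: (hM); exact: (mxinM HS).
  - by apply: (hM); apply: (mxinM HS).
  - by apply: (hM); apply: (hM); apply: (mxinM HS).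
  - by apply: (hM); apply: (hM); apply: (mxinM HS).
exists (fun x => ext (fun i => vec_mx (row i (vec_mx x)) - E *m F)).
exists (fun t s => ext (tangent t s)); split.
- apply: (ext_in) => [|i]; first exact: polyfun_ring.
  apply: (mxinB (polyfun_ring k _)); last exact: mxin_const (polyfun_ring k _) _ _ _.
  by apply: mxin_vec_mx; apply: mxin_row; apply: mxin_vec_mx; apply: mxin_id.
- move=> t; have HS := polycurve_ring k; apply: (ext_in) => // i.
  have hC p q (M : 'M_(p, q)) : mxin (@polycurve k) (fun=> M) by apply: mxin_const.
  have hX : mxin (@polycurve k) (fun s => s *: parX t).
    by apply: (mxinZ HS) => //; apply: polycurve_id.
  have hw := mxin_chart_row HS c hX; have hK := mxin_chart_ker HS c hX.
  have hM := @mxinM _ _ _ HS; have hT := @mxin_tr _ _ (@polycurve k).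
  apply: (mxinD HS); first apply: (mxinD HS); first apply: (mxinD HS) => //.
  + exact: (hM) hw.
  + apply: (hM) (hC _ _ _); apply: (hM) (hC _ _ _); apply: (hM) (hC _ _ _).
    apply: (hM) (hT _ _ _ hw); apply: (hM) (hC _ _ _).
    by apply: (mxinB HS) => //; apply: (hM) hw.
  + by apply: (hM) (hC _ _ _); apply: (hM) (hT _ _ _ hK); apply: (hM) hK (hC _ _ _).
- move=> t s; rewrite -extZ; congr ext; apply/funext => i.
  by rewrite coordsK family_tangent addrC addKr.
move=> t; rewrite -[RHS]packK /ext.
have tE i : tangent t 0 i = E *m parX t *m F' + E *m parL t i *m F +
    H *m F^T *m parR t i *m E^T *m invmx H + E' *m parD t i *m E'^T *m invmx H.
  rewrite /tangent scale0r /chart_row /chart_ker mul0mx mulmx0 addr0 subr0.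
  congr (_ + _ + _); rewrite !mulmxBl mul1mx -!mulmxA -/F.
  by rewrite (mulmxA F) (mulmxA (F *m H)) iso !mul0mx mulmx0 subr0.
have [FE [FE' [F'E F'E']]] : F *m E = 1%:M /\ F *m E' = 0 /\ F' *m E = 0 /\ F' *m E' = 1%:M.
  by rewrite chFE chFE' chF'E chF'E'.
have FY i : F *m tangent t 0 i = parX t *m F' + parL t i *m F.
  by rewrite tE !mulmxDr !mulmxA FE FE' iso !mul0mx !mul1mx !addr0.
have F'Y i : F' *m tangent t 0 i *m H =
    F' *m H *m F^T *m parR t i *m E^T + parD t i *m E'^T.
  rewrite tE !mulmxDr !mulmxA F'E F'E' !mul0mx mul1mx !add0r mulmxDl.
  by rewrite !mulmxKV.
congr pack.
- rewrite FY mulmxDl -!mulmxA F'E' FE' mulmx0 mulmx1 addr0 /parX vec_mxK.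
  by rewrite mulmxKp.
- by apply/funext => i; rewrite FY mulmxDl -!mulmxA F'E FE mulmx0 mulmx1 add0r.
- apply/funext => i; rewrite -!mulmxA (mulmxA F') (mulmxA _ H) F'Y mulmxDl.
  rewrite -!mulmxA -!trmx_mul FE FE' trmx1 trmx0 !mulmx0 addr0 mulmx1.
  have -> : E' *m (F' *m (H *m (F^T *m parR t i))) =
      H *m F^T *m parR t i - E *m (F *m H *m F^T) *m parR t i.
    rewrite mulmxA; have -> : E' *m F' = 1%:M - E *m F.
      by rewrite -(chEF c) addrC addKr.
    by rewrite mulmxBl mul1mx -!mulmxA.
  rewrite iso mulmx0 mul0mx subr0 -!mulmxA mulKmx // mulmxA -trmx_mul FE.
  by rewrite trmx1 mul1mx.
- apply/funext => i; rewrite F'Y mulmxDl -!mulmxA -!trmx_mul F'E F'E'.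
  by rewrite trmx0 trmx1 !mulmx0 mulmx1 add0r.
Qed.

End Family.

End Families.

(** * Dimension bounds for the strata *)
Section Strata.
Local Open Scope ring_scope.
Local Open Scope classical_set_scope.
Variables (k : closedFieldType) (n : nat) (H : 'M[k]_n).
Hypothesis H_unit : H \in unitmx.

Section Nondegenerate.
Variables (r d e : nat) (c : chart k n d e).
Let N := (d * e + r * (d * d + e * e))%N.

(** When [K = w H w^T] is invertible, the blocks satisfy [L K = K R], that is
    [L = K S] and [R = S K] for one matrix [S]. *)
Lemma algdep_nondegenerate_family :
  algdep (@coords k n r @` [set A | exists X,
     chart_row c X *m H *m (chart_row c X)^T \in unitmx /\
     forall i, stabilizes H (chart_row c X) (tnth A i)]) N.+1.
Proof.
pose X (t : 'rV[k]_N) : 'M_(d, e) := vec_mx (lsubmx t).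
pose row (t : 'rV[k]_N) i : 'rV[k]_(d * d + e * e) := row i (vec_mx (rsubmx t) : 'M_(r, _)).
pose S (t : 'rV[k]_N) i : 'M[k]_d := vec_mx (lsubmx (row t i)).
pose D (t : 'rV[k]_N) i : 'M[k]_e := vec_mx (rsubmx (row t i)).
pose K t := chart_row c (X t) *m H *m (chart_row c (X t))^T.
pose fam t := [tuple member H c (X t) (K t *m S t i) (S t i *m K t) (D t i) | i < r].
have HS := @polyfun_ring k N; have hid := @mxin_id k N.
have hX : mxin (@polyfun k N) X by apply: mxin_vec_mx; apply: mxin_lsubmx.
have hrow i : mxin (@polyfun k N) (row^~ i).
  by apply: mxin_row; apply: mxin_vec_mx; apply: mxin_rsubmx.
have hS i : mxin (@polyfun k N) (S^~ i) by apply: mxin_vec_mx; apply: mxin_lsubmx.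
have hD i : mxin (@polyfun k N) (D^~ i) by apply: mxin_vec_mx; apply: mxin_rsubmx.
have hK : mxin (@polyfun k N) K.
  have hw := mxin_chart_row HS c hX.
  apply: (mxinM HS); last exact: mxin_tr.
  by apply: (mxinM HS) => //; apply: mxin_const.
have hfam : mxin (@polyfun k N) (fun t => coords (fam t)).
  by apply: mxin_coords => i; apply: mxin_member => //; apply: (mxinM HS).
apply: algdepW (algdep_image hfam (ltnSn N)) => _ [A [X0 [K0 hA]] <-].
pose K1 := chart_row c X0 *m H *m (chart_row c X0)^T.
have /choice[p hp] i : exists p : 'M_d * 'M_e,
    tnth A i = member H c X0 (K1 *m p.1) (p.1 *m K1) p.2.
  have [L [R [e1 e2]]] := hA i; have [D0 ->] := memberP H_unit e1 e2.
  have LKR : L *m K1 = K1 *m R.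
    by have := congr1 (mulmx (chart_row c X0)) e2; rewrite !mulmxA e1.
  exists (invmx K1 *m L, D0) => /=.
  by rewrite mulKVmx // -[_ *m L *m K1]mulmxA LKR mulKmx.
exists (row_mx (mxvec X0)
  (mxvec (\matrix_i row_mx (mxvec (p i).1) (mxvec (p i).2)))) => //.
congr coords; apply: eq_from_tnth => i.
rewrite tnth_mktuple hp /K /X /S /D /row !row_mxKl !row_mxKr !mxvecK !rowK.
by rewrite !row_mxKl !row_mxKr !mxvecK.
Qed.

End Nondegenerate.

Section ColumnCharts.
Variables (d e : nat).
Hypothesis nde : n = (d + e)%N.

Lemma colsub_chart (f : 'I_d -> 'I_n) : injective f ->
  exists c : chart k n d e, chE c = colsub f 1%:M.
Proof.
move=> fi; have [|c [_ cE]] := @chart_exists k n d e (rowsub f 1%:M) (colsub f 1%:M) nde.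
  apply/matrixP => i j; rewrite !mxE (bigD1 (f i)) //= !mxE eqxx mul1r.
  rewrite big1 ?addr0 ?inj_eq // => l; rewrite !mxE eq_sym => /negPf ->.
  by rewrite mul0r.
by exists c.
Qed.

(** A full-rank minor of [w]. *)
Lemma row_free_colsub (w : 'M[k]_(d, n)) : row_free w ->
  exists2 f : {ffun 'I_d -> 'I_n}, injective f & w *m colsub f 1%:M \in unitmx.
Proof.
move=> fw.
have ft : row_full w^T by rewrite /row_full mxrank_tr.
exists (fullrankfun ft); first exact: fullrankfun_inj.
have -> : w *m colsub (fullrankfun ft) 1%:M = (rowsub (fullrankfun ft) w^T)^T.
  apply/matrixP => i j; rewrite !mxE (bigD1 (fullrankfun ft j)) //= !mxE.
  rewrite eqxx mulr1 big1 ?addr0 // => l /negPf h.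
  by rewrite !mxE h mulr0.
by rewrite unitmx_tr; apply: fullrowsub_unit.
Qed.

(** Up to a change of basis of the subspace, [w] lies in one of finitely many
    charts. *)
Lemma algdep_column_charts r N (P : 'M[k]_(d, n) -> Prop) :
  (forall g w, g \in unitmx -> P w -> P (g *m w)) ->
  (forall c : chart k n d e, algdep (@coords k n r @` [set A | exists X,
     P (chart_row c X) /\
     forall i, stabilizes H (chart_row c X) (tnth A i)]) N) ->
  algdep (@coords k n r @` [set A | exists w : 'M_(d, n),
    [/\ row_free w, P w & forall i, stabilizes H w (tnth A i)]]) N.
Proof.
move=> Pg hP.
apply: (@algdepW _ _ _ [set x | exists f : {ffun 'I_d -> 'I_n},
   (@coords k n r @` [set A | exists w : 'M_(d, n),
    [/\ injective f, w *m colsub f 1%:M \in unitmx, P w &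
        forall i, stabilizes H w (tnth A i)]]) x]).
  move=> _ [A [w [fw Pw hA]] <-]; have [f fi fu] := row_free_colsub fw.
  by exists f, A => //; exists w.
apply: algdep_bigU => f; case: (pselect (injective f)) => [fi|nfi]; last first.
  by apply: algdepW (@algdep0 k _ N) => x [A [w []]].
have [c cE] := colsub_chart fi.
apply: algdepW (hP c) => _ [A [w [_ wu Pw hA]] <-]; exists A => //.
have [|X XE] := @chart_rowP _ _ _ _ c w; first by rewrite cE.
exists X; rewrite -XE; split=> [|i]; first by apply: Pg; rewrite ?unitmx_inv ?cE.
by apply: stabilizes_gauge; rewrite ?unitmx_inv ?cE.
Qed.

Lemma algdep_stratum r : algdep (@coords k n r @` [set A | exists w : 'M_(d, n),
    row_free w /\ forall i, stabilizes H w (tnth A i)])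
  (d * e + r * (d * d + (d * d + e * e))).+1.
Proof.
apply: (algdepW (Y := @coords k n r @` [set A | exists w : 'M_(d, n),
    [/\ row_free w, True & forall i, stabilizes H w (tnth A i)]])).
  by move=> _ [A [w [fw hA]] <-]; exists A => //; exists w.
apply: (algdep_column_charts (P := fun=> True)) => // c.
apply: algdepW (algdep_family H_unit c 1%:M) => _ [A [X [_ hA]] <-].
by exists A => //; exists (mxvec X) => i; rewrite mulmx1 mxvecK.
Qed.

Lemma algdep_nondegenerate_stratum r :
  algdep (@coords k n r @` [set A | exists w : 'M_(d, n),
    [/\ row_free w, w *m H *m w^T \in unitmx &
        forall i, stabilizes H w (tnth A i)]])
  (d * e + r * (d * d + e * e)).+1.
Proof.
apply: algdep_column_charts => [g w gu wu|c].
  by rewrite trmx_mul -!mulmxA unitmx_mul gu !mulmxA unitmx_mul wu unitmx_tr.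
exact: algdep_nondegenerate_family.
Qed.

End ColumnCharts.

End Strata.

(** * Symmetric matrices *)
Section Symmetric.
Local Open Scope ring_scope.
Variables (k : fieldType) (d : nat).

Definition sympair := {p : 'I_d * 'I_d | (p.1 <= p.2)%N}.

(** Counting each pair together with its transpose counts all pairs once, and
    those of the diagonal once more. *)
Lemma card_sympair : (#|{: sympair}|.*2 = d * d + d)%N.
Proof.
rewrite card_sig -sum1_card -(pair_big_dep xpredT (fun i j : 'I_d => i <= j)%N
  (fun _ _ => 1%N)) /=.
have E (b : 'I_d -> 'I_d -> bool) :
    (\sum_i \sum_(j | b i j) 1 = \sum_i \sum_j b i j)%N.
  by apply: eq_bigr => i _; rewrite big_mkcond; apply: eq_bigr => j _; case: (b i j).
rewrite -addnn {1}E E [X in (_ + X)%N]exchange_big -big_split /=.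
have -> : (d * d + d = \sum_(i < d) \sum_(j < d) (1 + (i == j)))%N.
  transitivity (\sum_(i < d) (d + 1))%N.
    by rewrite sum_nat_const card_ord mulnDr muln1.
  apply: eq_bigr => i _; rewrite big_split sum1_card card_ord; congr addn.
  rewrite (bigD1 i) //= eqxx big1 // => j /negPf; rewrite eq_sym => -> //.
apply: eq_bigr => i _; rewrite -big_split; apply: eq_bigr => j _.
by rewrite -val_eqE /=; case: ltngtP.
Qed.

Lemma sympair_proof (i j : 'I_d) :
  (let p := if i <= j then (i, j) else (j, i) in p.1 <= p.2)%N.
Proof. by case: leqP => //= /ltnW. Qed.

Definition sympair_of i j : sympair :=
  exist (fun p : 'I_d * 'I_d => (p.1 <= p.2)%N) _ (sympair_proof i j).

Lemma sympair_ofC i j : sympair_of i j = sympair_of j i.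
Proof.
by apply: val_inj => /=; case: ltngtP => // /val_inj ->.
Qed.

(** The rows form a basis of the space of the symmetric matrices. *)
Definition symmx : 'M[k]_(#|{: sympair}|, d * d) :=
  \matrix_l mxvec (\matrix_(i, j) (l == enum_rank (sympair_of i j))%:R).

Lemma symmxE (u : 'rV_#|{: sympair}|) i j :
  vec_mx (u *m symmx) i j = u 0 (enum_rank (sympair_of i j)).
Proof.
rewrite !mxE (bigD1 (enum_rank (sympair_of i j))) //= big1 => [|l /negPf h].
  by rewrite mxE mxvecE mxE eqxx mulr1 addr0.
by rewrite mxE mxvecE mxE h mulr0.
Qed.

Lemma symmx_tr u : (vec_mx (u *m symmx))^T = vec_mx (u *m symmx).
Proof. by apply/matrixP => i j; rewrite mxE !symmxE sympair_ofC. Qed.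

Lemma sympair_ofK (l : sympair) : sympair_of (val l).1 (val l).2 = l.
Proof. by apply: val_inj; case: l => -[i j] /= ->. Qed.

Lemma symmx_free : row_free symmx.
Proof.
rewrite -kermx_eq0; apply/eqP/row_matrixP => i; rewrite row0.
set u := row i _; have u0 : u *m symmx = 0.
  by apply/eqP; rewrite -sub_kermx row_sub.
apply/rowP => l; rewrite [RHS]mxE -(enum_valK l) -[enum_val l]sympair_ofK.
by rewrite -symmxE u0 linear0 mxE.
Qed.

Lemma symmxP (X : 'M[k]_d) : X^T = X -> exists u, X = vec_mx (u *m symmx).
Proof.
move=> XT; exists (\row_l X (val (enum_val l)).1 (val (enum_val l)).2).
apply/matrixP => i j; rewrite symmxE mxE enum_rankK /=.
by case: ifP => // _; rewrite -[in LHS]XT mxE.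
Qed.

End Symmetric.

(** * Lagrangian subspaces *)
Lemma rowsub_orth (k : fieldType) p d (f : 'I_p -> 'I_d) : injective f ->
  (rowsub f 1%:M *m (rowsub f 1%:M)^T = 1%:M :> 'M[k]_p)%R.
Proof.
move=> fi; apply/matrixP => i j; rewrite !mxE (bigD1 (f i)) //= !mxE eqxx mul1r.
rewrite big1 ?addr0 => [|l /negPf h].
  by rewrite eq_sym inj_eq // eq_sym.
by rewrite !mxE eq_sym h mul0r.
Qed.

Section Lagrangian.
Local Open Scope ring_scope.
Local Open Scope classical_set_scope.
Variables (k : closedFieldType) (n d : nat) (H : 'M[k]_n).
Hypothesis H_unit : H \in unitmx.
Hypothesis H_skew : H^T = - H.
Hypothesis two_neq0 : 2%:R != 0 :> k.
Hypothesis ndd : n = (d + d)%N.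

Definition darboux (F F' : 'M[k]_(d, n)) :=
  [/\ F *m H *m F^T = 0, F' *m H *m F'^T = 0, F *m H *m F'^T = 1%:M &
      F' *m H *m F^T = - 1%:M].

Lemma skew_tr p q (u : 'M[k]_(p, n)) (v : 'M_(q, n)) :
  v *m H *m u^T = - (u *m H *m v^T)^T.
Proof. by rewrite !trmx_mul trmxK H_skew mulNmx mulmxN mulmxA opprK. Qed.

(** A right inverse [v] of [w H] is made isotropic by subtracting half of
    [(v H v^T) w]. *)
Lemma darboux_exists (w : 'M[k]_(d, n)) :
  row_free w -> w *m H *m w^T = 0 -> exists F', darboux w F'.
Proof.
move=> fw iso.
have fwH : row_free (w *m H) by rewrite /row_free mxrankMfree // row_free_unit.
pose v := (pinvmx (w *m H))^T.
have wv : w *m H *m v^T = 1%:M by rewrite trmxK mulmxVp.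
have vw : v *m H *m w^T = - 1%:M by rewrite skew_tr wv trmx1.
pose K := v *m H *m v^T; pose Y := - (2%:R^-1 *: K).
have wF : w *m H *m (v + Y *m w)^T = 1%:M.
  by rewrite linearD /= trmx_mul mulmxDr mulmxA iso mul0mx addr0.
exists (v + Y *m w); split=> //; last by rewrite skew_tr wF trmx1.
have YT : Y^T = - Y.
  by rewrite /Y linearN linearZ /= /K [in LHS]skew_tr linearN /= trmxK scalerN.
rewrite mulmxDl mulmxDl -!mulmxA [w *m _]mulmxA wF mulmx1 linearD /= trmx_mul YT.
rewrite mulmxDr mulmxDr !mulmxA vw mulNmx mul1mx opprK -/K -addrA.
by rewrite -mulr2n -scaler_nat /Y scalerN scalerA mulfV // scale1r subrr.
Qed.

(** A right inverse of a square matrix is a left inverse. *)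
Lemma square_chart (F F' : 'M[k]_(d, n)) (E E' : 'M_(n, d)) :
  F *m E = 1%:M -> F *m E' = 0 -> F' *m E = 0 -> F' *m E' = 1%:M ->
  E *m F + E' *m F' = 1%:M.
Proof.
clear -ndd; subst n => FE FE' F'E F'E'.
rewrite -mul_row_col; apply: mulmx1C.
by rewrite mul_col_row FE FE' F'E F'E' -scalar_mx_block.
Qed.

Lemma darboux_chart F F' : darboux F F' ->
  exists c : chart k n d d, [/\ chF c = F, chF' c = F', chE c = H *m F'^T &
    chE' c = - (H *m F^T)].
Proof.
move=> [FF F'F' FF' F'F].
have e1 : F *m (H *m F'^T) = 1%:M by rewrite mulmxA.
have e2 : F *m - (H *m F^T) = 0 by rewrite mulmxN mulmxA FF oppr0.
have e3 : F' *m (H *m F'^T) = 0 by rewrite mulmxA.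
have e4 : F' *m - (H *m F^T) = 1%:M by rewrite mulmxN mulmxA F'F opprK.
by exists (Chart e1 e2 e3 e4 (square_chart e1 e2 e3 e4)).
Qed.

Lemma darboux_form F F' (a b a' b' : 'M[k]_d) : darboux F F' ->
  (a *m F + b *m F') *m H *m (a' *m F + b' *m F')^T = a *m b'^T - b *m a'^T.
Proof.
move=> [FF F'F' FF' F'F]; rewrite linearD /= !trmx_mul !mulmxDl !mulmxDr.
have E (G G' : 'M_(d, n)) (x y : 'M_d) :
  x *m G *m H *m (G'^T *m y) = x *m (G *m H *m G'^T) *m y by rewrite !mulmxA.
rewrite !E FF F'F' FF' F'F !mulmx0 !mul0mx add0r addr0 mulmx1.
by rewrite mulmxN mulmx1 mulNmx.
Qed.

Lemma darboux_chart_row (c : chart k n d d) X : darboux (chF c) (chF' c) ->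
  chart_row c X *m H *m (chart_row c X)^T = X^T - X.
Proof.
move=> dF; have := darboux_form 1%:M X 1%:M X dF.
by rewrite !mul1mx trmx1 mulmx1.
Qed.

(** On the coordinates selected by the projector [1 - g], the pair [(F, F')] is
    rotated to [(- F', F)]. *)
Definition swapF (g : 'M[k]_d) (F F' : 'M[k]_(d, n)) := g *m F - (1%:M - g) *m F'.
Definition swapF' (g : 'M[k]_d) (F F' : 'M[k]_(d, n)) := (1%:M - g) *m F + g *m F'.

Lemma darboux_swap g F F' : g^T = g -> g *m g = g -> darboux F F' ->
  darboux (swapF g F F') (swapF' g F F').
Proof.
move=> gT gg dF; set h := 1%:M - g.
have hT : h^T = h by rewrite linearB /= trmx1 gT.
have hNT : (- h)^T = - h by rewrite linearN /= hT.
have gh : g *m h = 0 by rewrite mulmxBr mulmx1 gg subrr.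
have hg : h *m g = 0 by rewrite mulmxBl mul1mx gg subrr.
have hh : h *m h = h by rewrite mulmxBr mulmx1 hg subr0.
have gDh : g + h = 1%:M by rewrite addrC subrK.
rewrite /darboux /swapF /swapF' -/h -mulNmx.
split; rewrite darboux_form // ?hNT ?hT ?gT.
- by rewrite mulmxN mulNmx gh hg subrr.
- by rewrite hg gh subrr.
- by rewrite gg mulNmx hh opprK.
- by rewrite mulmxN hh gg -opprD addrC gDh.
Qed.

(** The index function [f] enumerates columns of [a] that form a basis of its
    column space; [g] is the diagonal projector onto them. *)
Lemma column_projector (a : 'M[k]_d) : exists p (f : {ffun 'I_p -> 'I_d}),
  let g := (rowsub f 1%:M)^T *m rowsub f 1%:M in
  [/\ (p <= d)%N, injective f,
      forall x : 'rV_d, x *m a *m g = 0 -> x *m a = 0 &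
      forall v : 'cV_d, a *m g *m v = 0 -> g *m v = 0].
Proof.
exists (\rank a^T), (maxrankfun a^T) => g.
pose S := rowsub (maxrankfun a^T) 1%:M : 'M[k]_(_, d).
have SS : S *m S^T = 1%:M by apply: rowsub_orth; apply: maxrankfun_inj.
have Sa : S *m a^T = rowsub (maxrankfun a^T) a^T by rewrite [RHS]rowsubE.
split; [exact: rank_leq_col | exact: maxrankfun_inj | |].
- move=> x xag.
  have xaS : S *m a^T *m x^T = 0.
    apply: trmx_inj; rewrite trmx0 !trmx_mul !trmxK.
    have := congr1 (mulmx^~ S^T) xag.
    by rewrite /g /= !mulmxA -[_ *m S *m S^T]mulmxA SS mulmx1 mul0mx.
  have /submxP[D aD] : (a^T <= S *m a^T)%MS by rewrite Sa eq_maxrowsub.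
  by apply: trmx_inj; rewrite trmx_mul trmx0 aD -mulmxA xaS mulmx0.
- move=> v; rewrite /g !mulmxA -/S => /(congr1 trmx).
  rewrite !trmx_mul trmxK trmx0 Sa mulmxA => h.
  have := congr1 (mulmx^~ (pinvmx (rowsub (maxrankfun a^T) a^T))) h.
  rewrite /= mul0mx mulmxKp ?maxrowsub_free // => vS.
  by rewrite -mulmxA -[S *m v]trmxK trmx_mul vS trmx0 mulmx0.
Qed.

(** Write [w = a F + b F'] and let [g] select a basis of the column space of [a].
    If [x] kills [a g - b (1 - g)], it kills [a g], hence [a], and [b (1 - g)].  So
    [x w = u F'] with [u = x b = u g], and since [w] is isotropic [a u^T = 0];
    as the columns of [a] selected by [g] are independent, [u = 0]. *)
Lemma lagrangian_transversal F F' (w : 'M[k]_(d, n)) : darboux F F' ->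
  row_free w -> w *m H *m w^T = 0 ->
  exists p (f : {ffun 'I_p -> 'I_d}),
  let g := (rowsub f 1%:M)^T *m rowsub f 1%:M in
  [/\ (p <= d)%N, injective f & w *m H *m (swapF' g F F')^T \in unitmx].
Proof.
move=> dF fw iso; have [c [cF cF' cE cE']] := darboux_chart dF.
have [FF F'F' FF' F'F] := dF.
pose a := w *m H *m F'^T; pose b := - (w *m H *m F^T).
have wE : w = a *m F + b *m F'.
  rewrite -[LHS]mulmx1 -(chEF c) cF cF' cE cE' mulmxDr !mulmxA.
  by rewrite /b !(mulmxN, mulNmx) !mulmxA.
have [p [f [pd fi ag gv]]] := column_projector a.
exists p, f => g; split=> //.
have gT : g^T = g by rewrite trmx_mul trmxK.
have gg : g *m g = g.
  by rewrite /g mulmxA -[_ *m rowsub f _ *m _]mulmxA rowsub_orth // mulmx1.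
rewrite -/g in ag gv; clearbody g.
have -> : w *m H *m (swapF' g F F')^T = a *m g - b *m (1%:M - g).
  rewrite /swapF' linearD /= !trmx_mul linearB /= trmx1 gT [LHS]mulmxDr !mulmxA.
  by rewrite addrC /b mulNmx opprK.
have aT : a^T = - (F' *m H *m w^T) by rewrite skew_tr opprK.
clearbody a b.
rewrite -row_free_unit -kermx_eq0; apply/eqP/row_matrixP => i; rewrite row0.
set x := row i _; have : x *m (a *m g - b *m (1%:M - g)) = 0.
  by apply/eqP; rewrite -sub_kermx row_sub.
rewrite mulmxBr !mulmxA => e.
have hg : (1%:M - g) *m g = 0 by rewrite mulmxBl mul1mx gg subrr.
have xa : x *m a = 0.
  apply: ag; have := congr1 (mulmx^~ g) e.
  rewrite /= mulmxBl -[_ *m g *m g]mulmxA gg -[_ *m (1%:M - g) *m g]mulmxA hg.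
  by rewrite mulmx0 subr0 mul0mx.
have xbh : x *m b *m (1%:M - g) = 0.
  by move: e; rewrite xa mul0mx sub0r => /eqP; rewrite oppr_eq0 => /eqP.
have xbg : x *m b = x *m b *m g.
  by apply/eqP; rewrite -subr_eq0 -{1}[x *m b]mulmx1 -mulmxBr xbh.
have abx : a *m (x *m b)^T = 0.
  apply: trmx_inj; rewrite trmx_mul trmxK trmx0.
  have : x *m w *m H *m w^T = 0 by rewrite -!mulmxA mulmxA -mulmxA (mulmxA w) iso mulmx0.
  rewrite {1}wE mulmxDr mulmxA xa mul0mx add0r.
  by rewrite aT mulmxN !mulmxA => ->; rewrite oppr0.
have xb : x *m b = 0.
  apply: trmx_inj; rewrite trmx0 xbg trmx_mul gT; apply: gv.
  by rewrite -mulmxA -{1}gT -trmx_mul -xbg.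
have xw : x *m w = 0 by rewrite wE mulmxDr !mulmxA xa xb !mul0mx addr0.
by have := congr1 (mulmx^~ (pinvmx w)) xw; rewrite /= mul0mx mulmxKp.
Qed.

(** In a chart given by a Darboux pair, the isotropic subspaces are those of the
    symmetric matrices [X], and finitely many rotations of one Darboux pair
    provide a chart around every Lagrangian subspace. *)
Lemma algdep_lagrangian_stratum r :
  algdep (@coords k n r @` [set A | exists w : 'M_(d, n),
    [/\ row_free w, w *m H *m w^T = 0 & forall i, stabilizes H w (tnth A i)]])
  (#|{: sympair d}| + r * (d * d + (d * d + d * d))).+1.
Proof.
case: (pselect (exists w : 'M[k]_(d, n), row_free w /\ w *m H *m w^T = 0)); last first.
  move=> h; apply: algdepW (@algdep0 k _ _) => x [A [w [fw iso _]]].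
  by case: h; exists w.
move=> [F [fF isoF]]; have [F' dF] := darboux_exists fF isoF.
apply: (@algdepW _ _ _ [set x | exists pf : {p : 'I_d.+1 & {ffun 'I_p -> 'I_d}},
  (@coords k n r @` [set A | exists w : 'M_(d, n),
    let f := tagged pf in
    let g := (rowsub f 1%:M)^T *m rowsub f 1%:M in
    [/\ injective f, w *m H *m (swapF' g F F')^T \in unitmx, w *m H *m w^T = 0 &
        forall i, stabilizes H w (tnth A i)]]) x]).
  move=> _ [A [w [fw iso hA]] <-].
  have [p [f [pd fi fu]]] := lagrangian_transversal dF fw iso.
  by exists (existT _ (Ordinal (pd : p < d.+1)%N) f), A => //; exists w.
apply: algdep_bigU => -[p f] /=.
case: (pselect (injective f)) => [fi|nfi]; last first.
  by apply: algdepW (@algdep0 k _ _) => x [A [w []]].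
set g := _ *m _.
have gT : g^T = g by rewrite trmx_mul trmxK.
have gg : g *m g = g.
  by rewrite /g mulmxA -[_ *m rowsub f _ *m _]mulmxA rowsub_orth // mulmx1.
have dS := darboux_swap gT gg dF.
have [c [cF cF' cE _]] := darboux_chart dS.
apply: algdepW (algdep_family H_unit c (@symmx k d)) => _ [A [w [_ wu iso hA]] <-].
exists A => //.
have wE : w *m chE c \in unitmx by rewrite cE mulmxA.
have [Y YE] := chart_rowP wE.
have isoY : chart_row c Y *m H *m (chart_row c Y)^T = 0.
  by rewrite -YE trmx_mul !mulmxA -(mulmxA _ w H) -(mulmxA _ _ w^T) iso mulmx0 mul0mx.
have [u uE] : exists u, Y = vec_mx (u *m symmx k d).
  apply: symmxP; apply/eqP; rewrite -subr_eq0 -(darboux_chart_row (c := c)) ?isoY //.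
  by rewrite cF cF'.
exists u => i; rewrite -uE -YE.
by apply: stabilizes_gauge; rewrite ?unitmx_inv.
Qed.

End Lagrangian.

(** * The stratification of the nongenerating tuples *)
Section Stratification.
Local Open Scope ring_scope.
Local Open Scope classical_set_scope.
Variables (k : closedFieldType) (n : nat) (H : 'M[k]_n).
Hypothesis H_unit : H \in unitmx.
Hypothesis H_skew : H^T = - H.
Hypothesis H_alt : forall x : 'rV[k]_n, x *m H *m x^T = 0.

(** Orthogonality is meant for the form of matrix [H] on row vectors. *)
Definition perp p (W : 'M[k]_(p, n)) : 'M[k]_n := kermx (H *m W^T).

Lemma form_mul p q p' q' (D : 'M_(p, q)) (M : 'M[k]_(q, n)) (D' : 'M_(p', q'))
    (N : 'M[k]_(q', n)) :
  D *m M *m H *m (D' *m N)^T = D *m (M *m H *m N^T) *m D'^T.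
Proof. by rewrite trmx_mul !mulmxA. Qed.

Lemma perpP p q (W : 'M[k]_(p, n)) (v : 'M_(q, n)) :
  reflect (v *m H *m W^T = 0) (v <= perp W)%MS.
Proof. by rewrite -mulmxA; apply: sub_kermxP. Qed.

Lemma rank_perp p (W : 'M[k]_(p, n)) : \rank (perp W) = (n - \rank W)%N.
Proof.
rewrite mxrank_ker -mxrank_tr trmx_mul trmxK mxrankMfree //.
by rewrite row_free_unit unitmx_tr.
Qed.

(** A maximal isotropic subspace is its own orthogonal space. *)
Lemma lagrangian_exists : exists d (w : 'M[k]_(d, n)),
  [/\ n = (d + d)%N, row_free w & w *m H *m w^T = 0].
Proof.
pose Q a := exists2 W : 'M[k]_n, W *m H *m W^T = 0 & (n - \rank W = a)%N.
have [|a [W iso rW] amin] := @prop_ex_minn Q.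
  by exists n, 0; rewrite ?mul0mx // mxrank0 subn0.
have le : (W <= perp W)%MS by apply/perpP.
have rle := mxrankS le; rewrite rank_perp in rle.
have Wn := rank_leq_row W.
have ge : (perp W <= W)%MS.
  apply: contraT => /row_subPn[i]; set v := row i _ => vW.
  have vP : v *m H *m W^T = 0 by apply/perpP; apply: row_sub.
  have Wv : W *m H *m v^T = 0 by rewrite (skew_tr H_skew) vP trmx0 oppr0.
  have lt : (W < W + v)%MS.
    rewrite ltmxE addsmxSl; apply: contra vW; apply: submx_trans.
    exact: addsmxSr.
  have isoc : col_mx W v *m H *m (col_mx W v)^T = 0.
    rewrite tr_col_mx mul_col_mx mul_col_row iso vP Wv H_alt.
    by rewrite -[block_mx _ _ _ _]/(block_mx 0 0 0 0) block_mx0.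
  have /submxP[D DE] : (W + v <= col_mx W v)%MS by rewrite addsmxE.
  have : (a <= n - \rank (W + v)%MS)%N.
    apply: amin; exists (W + v)%MS => //; rewrite DE.
    by rewrite form_mul isoc mulmx0 mul0mx.
  by have := rank_ltmx lt; have := rank_leq_row (W + v)%MS; lia.
have rge := mxrankS ge; rewrite rank_perp in rge.
exists (\rank W), (row_base W); split; [lia | exact: row_base_free |].
have /submxP[D ->] : (row_base W <= W)%MS by rewrite eq_row_base.
by rewrite form_mul iso mulmx0 mul0mx.
Qed.

Variables (rho : 'M[k]_n -> 'M[k]_n).
Hypothesis rhoE : forall A, rho A = H *m A^T *m invmx H.

Lemma rhoK A : rho (rho A) = A.
Proof.
have e : (invmx H)^T = - invmx H.
  apply: (can_inj (mulKmx H_unit)); rewrite mulmxN mulmxV //.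
  apply: trmx_inj; rewrite trmx_mul trmxK H_skew mulmxN mulVmx //.
  by rewrite linearN /= trmx1.
rewrite !rhoE !trmx_mul trmxK H_skew e !(mulmxN, mulNmx) opprK !mulmxA.
by rewrite mulmxV // mul1mx mulmxK.
Qed.

Lemma mul_rho_tr A : H *m (rho A)^T = A *m H.
Proof.
rewrite -{2}(rhoK A) [in RHS]rhoE.
by rewrite mulmxKV.
Qed.

Lemma stabilizesP d (w : 'M[k]_(d, n)) A :
  stabilizes H w A <-> (w *m A <= w)%MS /\ (w *m rho A <= w)%MS.
Proof.
split=> [[L [R [e1 e2]]]|[/submxP[L e1] /submxP[Q e2]]].
  split; first by rewrite e1 submxMl.
  apply/submxP; exists R^T; rewrite rhoE !mulmxA.
  have := congr1 trmx e2; rewrite !trmx_mul !trmxK H_skew !(mulmxN, mulNmx).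
  by move/oppr_inj; rewrite !mulmxA => ->; rewrite mulmxK.
exists L, Q^T; split=> //.
by rewrite -mul_rho_tr -mulmxA -trmx_mul e2 trmx_mul mulmxA.
Qed.

Lemma perp_stable p (W : 'M[k]_(p, n)) A :
  (W *m rho A <= W)%MS -> (perp W *m A <= perp W)%MS.
Proof.
move=> /submxP[Q e]; apply/perpP.
have := perpP _ _ (submx_refl (perp W)); move: (perp W) => P P0.
have -> : P *m A *m H *m W^T = P *m H *m (W *m rho A)^T.
  by rewrite trmx_mul !mulmxA -(mulmxA P H) mul_rho_tr !mulmxA.
by rewrite e trmx_mul mulmxA P0 mul0mx.
Qed.

Definition stable p (W : 'M[k]_(p, n)) A :=
  (W *m A <= W)%MS /\ (W *m rho A <= W)%MS.

Lemma stable_perp p (W : 'M[k]_(p, n)) A : stable W A -> stable (perp W) A.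
Proof. by move=> [h1 h2]; split; apply: perp_stable; rewrite ?rhoK. Qed.

Lemma stable_cap (W W' : 'M[k]_n) A :
  stable W A -> stable W' A -> stable (W :&: W')%MS A.
Proof.
move=> [h1 h2] [h3 h4]; split; rewrite sub_capmx.
  by rewrite (submx_trans _ h1) ?(submx_trans _ h3) ?submxMr ?capmxSl ?capmxSr.
by rewrite (submx_trans _ h2) ?(submx_trans _ h4) ?submxMr ?capmxSl ?capmxSr.
Qed.

Lemma stable_row_base (W : 'M[k]_n) A :
  stable W A -> stabilizes H (row_base W) A.
Proof.
move=> [h1 h2]; apply/stabilizesP.
by split; rewrite eq_row_base; [apply: submx_trans h1|apply: submx_trans h2];
   apply: submxMr; rewrite eq_row_base.
Qed.

Variable r : nat.

(** Let [W] be a proper nonzero subspace invariant under the tuple and its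
    adjoint.  If its dimension exceeds [m], its orthogonal space is smaller.  If
    its dimension is [m], its radical is zero, or all of [W], or an invariant
    subspace of dimension strictly between [0] and [m]. *)
Lemma nongenerates_strata m (A : r.-tuple 'M[k]_n) :
  (0 < n)%N -> n = (m + m)%N -> ~ generates rho A ->
  [\/ exists d (w : 'M[k]_(d, n)),
        [/\ (0 < d < m)%N, row_free w & forall i, stabilizes H w (tnth A i)],
      exists w : 'M[k]_(m, n),
        [/\ row_free w, w *m H *m w^T = 0 & forall i, stabilizes H w (tnth A i)] |
      exists w : 'M[k]_(m, n),
        [/\ row_free w, w *m H *m w^T \in unitmx &
            forall i, stabilizes H w (tnth A i)]].
Proof.
move=> n0 nmm /(nongenerates_invariant n0)[W [W0 fW hW]].
have sW i : stable W (tnth A i) by split; [apply: (hW (inl i)) | apply: (hW (inr i))].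
have small (V : 'M[k]_n) : (forall i, stable V (tnth A i)) ->
    (0 < \rank V < m)%N -> exists d (w : 'M[k]_(d, n)),
        [/\ (0 < d < m)%N, row_free w & forall i, stabilizes H w (tnth A i)].
  move=> sV rV; exists (\rank V), (row_base V); split=> // [|i].
    exact: row_base_free.
  exact: stable_row_base.
have sP i := stable_perp (sW i); have sC i := stable_cap (sW i) (sP i).
have r0 : (0 < \rank W)%N by rewrite lt0n mxrank_eq0.
have rn : (\rank W < n)%N by rewrite ltn_neqAle fW rank_leq_row.
have rP := rank_perp W.
case: (ltngtP (\rank W) m) => [lt|gt|rW].
- by apply: Or31; apply: (small W); rewrite ?r0.
- by apply: Or31; apply: (small (perp W)) => //; rewrite rP; lia.
set C := (W :&: perp W)%MS in sC.
have rC : (\rank C <= m)%N by rewrite -rW; apply/mxrankS/capmxSl.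
have [w [wW fw]] : exists w : 'M[k]_(m, n), (w :=: W)%MS /\ row_free w.
  rewrite -rW; exists (row_base W); split; first exact: eq_row_base.
  exact: row_base_free.
have sw i : stabilizes H w (tnth A i).
  have [h1 h2] := sW i; apply/stabilizesP.
  by rewrite !wW; split; [apply: submx_trans h1|apply: submx_trans h2];
     apply: submxMr; rewrite wW.
case: (posnP (\rank C)) => [C0|Cpos].
  apply: Or33; exists w; split=> //.
  rewrite -row_free_unit -kermx_eq0; apply/eqP/row_matrixP => i; rewrite row0.
  set x := row i _; have xK : x *m (w *m H *m w^T) = 0.
    by apply/eqP; rewrite -sub_kermx row_sub.
  have : (x *m w <= C)%MS.
    rewrite sub_capmx -{1}wW submxMl; apply/perpP.
    have /submxP[D ->] : (W <= w)%MS by rewrite wW.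
    by rewrite form_mul xK mul0mx.
  have -> : C = 0 by apply/eqP; rewrite -mxrank_eq0 C0.
  rewrite submx0 => /eqP xw.
  by have := congr1 (mulmx^~ (pinvmx w)) xw; rewrite /= mul0mx mulmxKp.
case: (ltnP (\rank C) m) => [lt|ge].
  by apply: Or31; apply: (small C) => //; rewrite Cpos.
apply: Or32; exists w; split=> //.
have CW : (W <= C)%MS.
  have := mxrank_leqif_sup (capmxSl W (perp W)); case=> _ <-.
  by rewrite eqn_leq -/C rW rC ge.
have WP : (W <= perp W)%MS by apply: submx_trans CW _; apply: capmxSr.
have /submxP[D DE] : (w <= W)%MS by rewrite wW.
have : (w <= perp W)%MS by rewrite wW.
by move/perpP => h; rewrite [in X in _ *m X]DE trmx_mul mulmxA h mul0mx.
Qed.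

Lemma stabilizes_nongenerating d (w : 'M[k]_(d, n)) (A : r.-tuple 'M[k]_n) :
  (0 < d < n)%N -> row_free w -> (forall i, stabilizes H w (tnth A i)) ->
  nongenerating r rho (coords A).
Proof.
move=> /andP[d0 dn] fw hw; exists A => //=.
apply: (@invariant_nongenerates _ _ _ _ _ <<w>>%MS).
- by rewrite -mxrank_eq0 genmxE (eqP fw) -lt0n.
- by rewrite /row_full genmxE (eqP fw) ltn_eqF.
have sub M : (w *m M <= w)%MS -> (<<w>> *m M <= <<w>>)%MS.
  move=> h; rewrite genmxE; apply: submx_trans h; apply: submxMr.
  by rewrite genmxE.
by case=> i /=; apply: sub; have /stabilizesP[] := hw i.
Qed.

End Stratification.

(** * The dimension of the variety of nongenerating tuples *)
Section NongeneratingDimension.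
Local Open Scope ring_scope.
Local Open Scope classical_set_scope.
Variables (k : closedFieldType) (n : nat) (H : 'M[k]_n).
Hypothesis H_unit : H \in unitmx.
Hypothesis H_skew : H^T = - H.
Hypothesis H_alt : forall x : 'rV[k]_n, x *m H *m x^T = 0.
Hypothesis two_neq0 : 2%:R != 0 :> k.
Variables (rho : 'M[k]_n -> 'M[k]_n) (r : nat).
Hypothesis rhoE : forall A, rho A = H *m A^T *m invmx H.

Lemma algdep_nongenerating m T : (0 < m)%N -> n = (m + m)%N ->
  (forall d, (0 < d < m)%N ->
     (d * (n - d) + r * (d * d + (d * d + (n - d) * (n - d))) <= T)%N) ->
  (m * m + r * (m * m + m * m) <= T)%N ->
  (#|{: sympair m}| + r * (m * m + (m * m + m * m)) <= T)%N ->
  algdep (nongenerating r rho) T.+1.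
Proof.
move=> m0 nmm h1 h2 h3.
have n0 : (0 < n)%N by lia.
have [X1 [X2 [X3 [sub [d1 d2 d3]]]]] : exists X1 X2 X3 : set 'rV[k]_(r * (n * n)),
    nongenerating r rho `<=` X1 `|` (X2 `|` X3) /\
    [/\ algdep X1 T.+1, algdep X2 T.+1 & algdep X3 T.+1].
  exists [set x | exists d : 'I_m, (@coords k n r @` [set A | exists w : 'M_(d, n),
    [/\ (0 < d)%N, row_free w & forall i, stabilizes H w (tnth A i)]]) x].
  exists (@coords k n r @` [set A | exists w : 'M_(m, n),
    [/\ row_free w, w *m H *m w^T = 0 & forall i, stabilizes H w (tnth A i)]]).
  exists (@coords k n r @` [set A | exists w : 'M_(m, n),
    [/\ row_free w, w *m H *m w^T \in unitmx &
        forall i, stabilizes H w (tnth A i)]]).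
  split=> [_ [A nA <-]|].
    have [[d [w [/andP[d0 dm] fw hw]]]|[w hw]|[w hw]] :=
      nongenerates_strata H_unit H_skew rhoE n0 nmm nA.
    - by left; exists (Ordinal dm), A => //; exists w.
    - by right; left; exists A => //; exists w.
    - by right; right; exists A => //; exists w.
  split.
  - apply: algdep_bigU => -[d dm] /=; case: (posnP d) => [d0|d0].
      by apply: algdepW (@algdep0 k _ _) => x [A [w [+ _ _] _]].
    have nd : n = (d + (n - d))%N by lia.
    have le : (_ < _.+1)%N := h1 d (introT andP (conj d0 dm)).
    apply: algdep_leq le _.
    have := algdep_stratum H_unit nd (r := r); apply: algdepW => _ [A [w [_ fw hw]] <-].
    by exists A => //; exists w.
  - apply: (algdep_leq _ (algdep_lagrangian_stratum H_unit H_skew two_neq0 nmm (r := r))).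
    by rewrite ltnS.
  - apply: (algdep_leq _ (algdep_nondegenerate_stratum H_unit nmm (r := r))).
    by rewrite ltnS.
by apply: algdepW sub _; apply: algdepU => //; apply: algdepU.
Qed.

Hypothesis r_gt0 : (0 < r)%N.

Lemma max_component_dim_family a d e (c : chart k n d e) (B : 'M[k]_(a, d * e)) T :
  (0 < d < n)%N -> row_free B ->
  (forall u, let w := chart_row c (vec_mx (u *m B)) in w *m H *m w^T = 0) ->
  T = (a + r * (d * d + (d * d + e * e)))%N ->
  algdep (nongenerating r rho) T.+1 ->
  max_component_dim (nongenerating r rho) T.
Proof.
move=> dn fB iso -> dep.
apply: (max_component_dim_immersive dep (mxin_family H c B)).
  apply: immersive_family => //.
  by have := iso 0; rewrite mul0mx linear0 /chart_row mul0mx addr0.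
move=> _ [t _ <-].
apply: (stabilizes_nongenerating H_unit H_skew rhoE dn (w := chart_row c (parX B t))).
  apply/row_freeP; exists (chE c); exact: chart_rowE.
by move=> i; rewrite tnth_mktuple; apply: member_stabilizes => //; apply: iso.
Qed.

(** Every line is isotropic, so the full chart of the projective space is
    available. *)
Lemma max_component_dim_line T : (1 < n)%N ->
  T = (n - 1 + r * (1 + (1 + (n - 1) * (n - 1))))%N ->
  algdep (nongenerating r rho) T.+1 ->
  max_component_dim (nongenerating r rho) T.
Proof.
move=> n1 TE; have nd : n = (1 + (n - 1))%N by rewrite subnKC // ltnW.
pose i0 : 'I_n := Ordinal (ltnW n1).
have [|c _] := @chart_exists k n 1 (n - 1) (delta_mx 0 i0) (delta_mx i0 0) nd.
  by rewrite mul_delta_mx; apply/matrixP => i j; rewrite !ord1 !mxE.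
apply: (max_component_dim_family (c := c) (B := 1%:M)) => //.
- by rewrite row_free_unit unitmx1.
- by rewrite TE !mul1n.
Qed.

Lemma max_component_dim_lagrangian m T : (0 < m)%N -> n = (m + m)%N ->
  T = (#|{: sympair m}| + r * (m * m + (m * m + m * m)))%N ->
  algdep (nongenerating r rho) T.+1 ->
  max_component_dim (nongenerating r rho) T.
Proof.
move=> m0 nmm TE; have [d [w [nd fw iso]]] := lagrangian_exists H_unit H_skew H_alt.
have dm : d = m by lia.
move: w fw iso; rewrite dm => w fw iso.
have [F' dF] := darboux_exists H_unit H_skew two_neq0 fw iso.
have [c [cF cF' _ _]] := darboux_chart nmm dF.
apply: (max_component_dim_family (c := c) (B := @symmx k m)) => //.
- by lia.
- exact: symmx_free.
move=> u /=; rewrite darboux_chart_row ?cF ?cF' //.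
by rewrite symmx_tr subrr.
Qed.

End NongeneratingDimension.

Section FormMatrix.
Local Open Scope ring_scope.

(** If [G] is the matrix of the form on column vectors, [H = G^-T].  An
    alternating form is obtained because [2] is invertible. *)
Lemma adjoint_matrix (k : closedFieldType) n (f : {skew_symmetric 'cV[k]_n})
    (rho : 'M[k]_n -> 'M[k]_n) :
  2%:R != 0 :> k -> nondegenerate f -> is_adjoint f rho -> exists H : 'M[k]_n,
  [/\ H \in unitmx, H^T = - H, forall x : 'rV[k]_n, x *m H *m x^T = 0 &
      forall A, rho A = H *m A^T *m invmx H].
Proof.
move=> two0 ndf adj.
pose G := \matrix_(i < n, j < n) f (delta_mx i 0) (delta_mx j 0).
have formE v w : f v w = (v^T *m G *m w) 0 0.
  have dec u : u = \sum_i u i 0 *: delta_mx i 0 :> 'cV[k]_n.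
    by rewrite {1}[u]matrix_sum_delta; apply: eq_bigr => i _; rewrite big_ord1.
  rewrite {1}[w]dec linear_sumr mxE; apply: eq_bigr => j _.
  rewrite linearZr_LR /= mulrC; congr (_ * _).
  rewrite {1}[v]dec linear_sumlz mxE; apply: eq_bigr => i _.
  by rewrite linearZl_LR /= !mxE.
have GT : G^T = - G.
  by apply/matrixP => i j; rewrite !mxE hermC expr1 mulN1r.
have Gu : G \in unitmx.
  rewrite -row_free_unit -kermx_eq0; apply/eqP/row_matrixP => i; rewrite row0.
  set u := row i _; have uG : u *m G = 0.
    by apply/eqP; rewrite -sub_kermx row_sub.
  apply: trmx_inj; rewrite trmx0; apply/eqP; rewrite -memv0 -(eqP ndf).
  by apply/mem_orthovP => w _; rewrite formE trmxK uG mul0mx mxE.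
have eqG (M N : 'M[k]_n) :
    (forall v w : 'cV_n, (v^T *m M *m w) 0 0 = (v^T *m N *m w) 0 0) -> M = N.
  move=> h; apply/matrixP => i j; have := h (delta_mx i 0) (delta_mx j 0).
  by rewrite trmx_delta -!rowE -!colE !mxE.
have rhoG A : (rho A)^T *m G = G *m A.
  by apply: eqG => v w; have := adj A v w; rewrite !formE trmx_mul !mulmxA.
pose H := invmx G^T.
have HG : H = - invmx G.
  apply: (can_inj (mulKmx Gu)); rewrite mulmxN mulmxV //.
  have -> : G *m H = - (G^T *m H) by rewrite GT mulNmx opprK.
  by rewrite mulmxV ?unitmx_tr.
have HT : H^T = - H by rewrite {2}HG opprK /H trmx_inv trmxK.
exists H; split=> //; first by rewrite unitmx_inv unitmx_tr.
- move=> x; have e : (x *m H *m x^T)^T = - (x *m H *m x^T).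
    by rewrite !trmx_mul trmxK HT mulmxA mulmxN mulNmx.
  move: (x *m H *m x^T) e => M e; apply/matrixP => i j; rewrite !ord1 [RHS]mxE.
  have /(congr1 (fun N : 'M[k]_1 => N 0 0)) := e; rewrite !mxE => {}e.
  apply/eqP; have : 2%:R * M 0 0 == 0 by rewrite mulr_natl mulr2n {1}e addNr.
  by rewrite mulf_eq0 (negPf two0).
move=> A; rewrite /H invmxK; apply: trmx_inj.
rewrite !trmx_mul !trmxK trmx_inv trmxK mulmxA -rhoG.
by rewrite mulmxK.
Qed.

End FormMatrix.

(** * Comparison of the dimensions *)
Section Comparison.

(** With [d = a + 1], [m = a + b + 2] and [r = q + 1], the difference of the two
    sides is [2 a b + q (a ^ 2 + 4 a b + 2 a)]. *)
Lemma stratum_dim_le m r d : 0 < r -> 0 < d < m ->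
  d * (m + m - d) +
    r * (d * d + (d * d + (m + m - d) * (m + m - d))) <=
  m + m - 1 + r * (1 + (1 + (m + m - 1) * (m + m - 1))).
Proof.
move=> r0 /andP[d0 dm].
have [a ea] : exists a, d = a.+1 by exists (d.-1); lia.
subst d.
have [b eb] : exists b, m = (a + b).+2 by exists ((m - a - 2)); lia.
subst m.
have [q eq] : exists q, r = q.+1 by exists (r.-1); lia.
subst r.
have -> : (a + b).+2 + (a + b).+2 - a.+1 = a + b + b + 3 by lia.
have -> : (a + b).+2 + (a + b).+2 - 1 = a + a + b + b + 3 by lia.
nia.
Qed.

Lemma nondegenerate_dim_le m r : 0 < r -> 0 < m ->
  m * m + r * (m * m + m * m) <=
  m + m - 1 + r * (1 + (1 + (m + m - 1) * (m + m - 1))).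
Proof.
move=> r0 m0.
have [a ea] : exists a, m = a.+1 by exists (m.-1); lia.
subst m.
have [q eq] : exists q, r = q.+1 by exists (r.-1); lia.
subst r.
have -> : a.+1 + a.+1 - 1 = a + a + 1 by lia.
nia.
Qed.

(** The difference of the two sides is
    [(r - 1) (m - 1) (m - 3) + (m - 1) (m - 4) / 2], which is negative for [m = 2]
    and [m = 3]: these are the exceptional values [n = 4] and [n = 6]. *)
Lemma lagrangian_dim_le m r s : 0 < r -> m = 1 \/ 4 <= m ->
  s.*2 = m * m + m ->
  s + r * (m * m + (m * m + m * m)) <=
  m + m - 1 + r * (1 + (1 + (m + m - 1) * (m + m - 1))).
Proof.
move=> r0 [->|m4] e; first by lia.
have [a ea] : exists a, m = a + 4 by exists ((m - 4)); lia.
subst m.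
have [q eq] : exists q, r = q.+1 by exists (r.-1); lia.
subst r.
have -> : a + 4 + (a + 4) - 1 = a + a + 7 by lia.
nia.
Qed.

Lemma line_dimE n r : 1 < n ->
  n ^ 2 * r - 2 * n * r + 3 * r + n - 1 =
  n - 1 + r * (1 + (1 + (n - 1) * (n - 1))).
Proof.
move=> n1; have [a ea] : exists a, n = a.+2 by exists ((n - 2)); lia.
subst n.
rewrite -mulnBl; have -> : a.+2 ^ 2 - 2 * a.+2 = a * a.+2.
  by rewrite expnS expn1 -mulnBl; congr (_ * _); lia.
have -> : a.+2 - 1 = a.+1 by lia.
nia.
Qed.

End Comparison.

Theorem corollary4p14 (k : closedFieldType) (n r : nat)
    (hchar : 2 \notin [pchar k]%R) (hn : 0 < n) (hr : 0 < r)
    (f : {skew_symmetric 'cV[k]_n}%R) (hf : nondegenerate f)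
    (rho : 'M[k]_n -> 'M[k]_n) (hrho : is_adjoint f rho) :
  [/\ n = 4 -> max_component_dim (nongenerating r rho) (12 * r + 3),
      n = 6 -> max_component_dim (nongenerating r rho) (27 * r + 6) &
      n = 2 \/ 8 <= n ->
        max_component_dim (nongenerating r rho)
          (n ^ 2 * r - 2 * n * r + 3 * r + n - 1)].
Proof.
have two0 : (2%:R != 0 :> k)%R by apply: contra hchar => h; rewrite inE /= h.
have [H [Hu HT Halt rhoE]] := adjoint_matrix two0 hf hrho.
have [m [w [nmm fw _]]] := lagrangian_exists Hu HT Halt.
have m0 : 0 < m by lia.
have sym := card_sympair m; set s := #|_| in sym.
have dep T := algdep_nongenerating Hu HT two0 rhoE m0 nmm (T := T) (r := r).
split=> n_eq.
- have m2 : m = 2 by lia.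
  apply: (max_component_dim_lagrangian Hu HT Halt two0 rhoE hr m0 nmm).
    by rewrite -/s; lia.
  apply: dep => [d /andP[d0]||].
  + rewrite m2 n_eq => d2; have -> : d = 1 by lia.
    lia.
  + by rewrite m2; lia.
  + by rewrite -/s m2; lia.
- have m3 : m = 3 by lia.
  apply: (max_component_dim_lagrangian Hu HT Halt two0 rhoE hr m0 nmm).
    by rewrite -/s; lia.
  apply: dep => [d /andP[d0]||].
  + rewrite m3 n_eq => d3; have [->|->] : d = 1 \/ d = 2 by lia.
      lia.
    lia.
  + by rewrite m3; lia.
  + by rewrite -/s m3; lia.
have n1 : 1 < n by lia.
rewrite line_dimE //.
apply: (max_component_dim_line Hu HT Halt rhoE hr n1 erefl).
apply: dep => [d dm||].
- by rewrite nmm; apply: stratum_dim_le.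
- by rewrite nmm; apply: nondegenerate_dim_le.
- by rewrite nmm; apply: lagrangian_dim_le => //; lia.
Qed.
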